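(* Let $\mathbb{X}$ be a separable reflexive Banach space whose dual $\mathbb{X}^*$ is uniformly convex, let $\mathbb{U}$ be a Hilbert space, and let $\mathrm{M}:L^2(J;\mathbb{U})\times\mathbb{U}^m\to\mathbb{X}$ be the controllability operator (defined in the context) of the linear impulsive neutral system $$\frac{d}{dt}\Big[x(t)+\int_{-\infty}^{t}\mathrm{G}(t-s)x(s)\,ds\Big]=\mathrm{A}x(t)+\int_{-\infty}^{t}\mathrm{N}(t-s)x(s)\,ds+\mathrm{B}u(t),\quad t\in[0,b]\setminus\{t_1,\dots,t_m\},$$ $$\Delta x(t_k)=\mathrm{D}_kx(t_k)+\mathrm{E}_kv_k,\ k=1,\dots,m,\qquad x(0)=x_0\in\mathbb{X}.$$ Let $\mathrm{M}\mathrm{M}^*:\mathbb{X}^*\to\mathbb{X}$ be the associated controllability Gramian, let $\mathscr{J}:\mathbb{X}\to\mathbb{X}^*$ be the duality mapping, and for $\alpha>0$, $y\in\mathbb{X}$ put $x_\alpha(y)=\alpha(\alpha \mathrm{I}+\mathrm{M}\mathrm{M}^*\mathscr{J})^{-1}(y)$. Then the following statements are equivalent: (i) $\mathrm{M}\mathrm{M}^*$ is strictly positive, i.e. $\langle x^*,\mathrm{M}\mathrm{M}^*x^*\rangle>0$ for every $0\neq x^*\in\mathbb{X}^*$. (ii) For every $h\in\mathbb{X}$, $\mathscr{J}(x_\alpha(h))$ converges weakly to zero in $\mathbb{X}^*$ as $\alpha\to0^+$. (iii) For every $y\in\mathbb{X}$, $x_\alpha(y)$ converges strongly to zero in $\mathbb{X}$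 as $\alpha\to0^+$.
   Context: **Data.** $J=[0,b]$, $0=t_0<t_1<\dots<t_m<t_{m+1}=b$. $\mathrm{A}:D(\mathrm{A})\subseteq\mathbb{X}\to\mathbb{X}$ and $\mathrm{N}(t):D(\mathrm{N}(t))\subseteq\mathbb{X}\to\mathbb{X}$ ($t\ge0$) are closed linear operators; $\mathrm{G}(t)\in\mathcal{L}(\mathbb{X})$ ($t\ge0$), $\mathrm{B}\in\mathcal{L}(\mathbb{U};\mathbb{X})$, $\mathrm{D}_k\in\mathcal{L}(\mathbb{X})$, $\mathrm{E}_k\in\mathcal{L}(\mathbb{U};\mathbb{X})$. The Hilbert space $\mathbb{U}$ is identified with its dual; $\langle\cdot,\cdot\rangle$ is the duality pairing between $\mathbb{X}$ and $\mathbb{X}^*$. $\Delta x(t_k)=x(t_k^+)-x(t_k^-)$ with $x(t_k^-)=x(t_k)$. **Standing conditions on $\mathrm{A},\mathrm{G},\mathrm{N}$.** $[D(\mathrm{A})]$ is $D(\mathrm{A})$ with the graph norm $\|\cdot\|_1$; $\hat{\ }$ is the Laplace transform; $\Lambda_\vartheta=\{\lambda\in\mathbb{C}\setminus\{0\}:|\arg\lambda|<\vartheta\}$; if $\mathbb{X}$ is real, resolvents and transforms are taken in the complexification. (Cd1) $\mathrm{A}$ generates an analytic semigroup, and there are $M_0>0$, $\vartheta\in(\pi/2,\pi)$ with $\Lambda_\vartheta\subseteq\rho(\mathrm{A})$ and $\|R(\lambda,\mathrm{A})\|\le M_0|\lambda|^{-1}$ on $\Lambda_\vartheta$. (Cd2)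 $\mathrm{G}:[0,\infty)\to\mathcal{L}(\mathbb{X})$ is strongly continuous, $\hat{\mathrm{G}}(\lambda)z$ converges absolutely for $z\in\mathbb{X}$, $\mathrm{Re}\,\lambda>0$, and $\hat{\mathrm{G}}$ has an analytic extension to $\Lambda_\vartheta$ with $\|\hat{\mathrm{G}}(\lambda)\|\le N_0|\lambda|^{-a}$ for some $a>0$, $N_0>0$, and $\|\hat{\mathrm{G}}(\lambda)z\|\le N_1|\lambda|^{-1}\|z\|_1$ for $z\in D(\mathrm{A})$. (Cd3) $D(\mathrm{A})\subseteq D(\mathrm{N}(t))$ for all $t\ge0$; $\mathrm{N}(\cdot)z$ is strongly measurable on $(0,\infty)$ for $z\in D(\mathrm{A})$; there is $\beta\in L^1_{loc}(\mathbb{R}^+)$ such that $\hat\beta(\lambda)$ exists for $\mathrm{Re}\,\lambda>0$ and $\|\mathrm{N}(t)z\|\le\beta(t)\|z\|_1$ for $t>0$, $z\in D(\mathrm{A})$; and $\hat{\mathrm{N}}:\Lambda_{\pi/2}\to\mathcal{L}([D(\mathrm{A})],\mathbb{X})$ has an analytic extension to $\Lambda_\vartheta$ with $\|\hat{\mathrm{N}}(\lambda)\|_{\mathcal{L}([D(\mathrm{A})],\mathbb{X})}\to0$ as $|\lambda|\to\infty$. (Cd4) There are a subspace $D\subseteq D(\mathrm{A})$ dense in $[D(\mathrm{A})]$ and $C_1,C_2>0$ with $\mathrm{A}(D)\subseteq D(\mathrm{A})$, $\hat{\mathrm{N}}(\lambda)(D)\subseteq D(\mathrm{A})$, $\hat{\mathrm{G}}(\lambda)(D)\subseteq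 D(\mathrm{A})$, $\|\mathrm{A}\hat{\mathrm{N}}(\lambda)z\|\le C_1\|z\|$ and $\|\hat{\mathrm{G}}(\lambda)z\|_1\le C_2|\lambda|^{-a}\|z\|_1$ for $z\in D$, $\lambda\in\Lambda_\vartheta$. **Resolvent operator.** Under these conditions there is a resolvent operator $(\mathscr{R}(t))_{t\ge0}\subset\mathcal{L}(\mathbb{X})$: it is strongly continuous and exponentially bounded, $\mathscr{R}(0)=\mathrm{I}$, and for each $z\in D(\mathrm{A})$, $\mathscr{R}(\cdot)z\in C([0,\infty);[D(\mathrm{A})])\cap C^1((0,\infty);\mathbb{X})$ with $\frac{d}{dt}[\mathscr{R}(t)z+\int_0^t\mathrm{G}(t-s)\mathscr{R}(s)z\,ds]=\mathrm{A}\mathscr{R}(t)z+\int_0^t\mathrm{N}(t-s)\mathscr{R}(s)z\,ds$ and $\frac{d}{dt}[\mathscr{R}(t)z+\int_0^t\mathscr{R}(t-s)\mathrm{G}(s)z\,ds]=\mathscr{R}(t)\mathrm{A}z+\int_0^t\mathscr{R}(t-s)\mathrm{N}(s)z\,ds$. It is bounded in norm on bounded time intervals. **Controllability operator.** Products $\prod_{j=k}^{i}A_j$ with $k\ge i$ mean $A_kA_{k-1}\cdots A_i$, and empty products (such as $\prod_{j=k}^{k+1}$) are $\mathrm{I}$. The bounded linear operator $\mathrm{M}$ is $$\mathrm{M}(u,\{v_k\})=\mathscr{R}(b-t_m)\sum_{i=1}^m\Big[\prod_{j=m}^{i+1}(\mathrm{I}+\mathrm{D}_j)\mathscr{R}(t_j-t_{j-1})\Big](\mathrm{I}+\mathrm{D}_i)\int_{t_{i-1}}^{t_i}\mathscr{R}(t_i-s)\mathrm{B}u(s)\,ds+\int_{t_m}^b\mathscr{R}(b-s)\mathrm{B}u(s)\,ds$$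 $$+\mathscr{R}(b-t_m)\sum_{i=2}^m\Big[\prod_{j=m}^{i}(\mathrm{I}+\mathrm{D}_j)\mathscr{R}(t_j-t_{j-1})\Big]\mathrm{E}_{i-1}v_{i-1}+\mathscr{R}(b-t_m)\mathrm{E}_mv_m .$$ $\mathrm{M}^*:\mathbb{X}^*\to L^2(J;\mathbb{U})\times\mathbb{U}^m$ is its adjoint. **Duality mapping.** $\mathscr{J}[z]=\{z^*\in\mathbb{X}^*:\langle z,z^*\rangle=\|z\|^2=\|z^*\|^2\}$; it is single-valued here because $\mathbb{X}^*$ is strictly convex. For each $\alpha>0$, $y\in\mathbb{X}$, the equation $\alpha x+\mathrm{M}\mathrm{M}^*\mathscr{J}[x]=\alpha y$ has a unique solution, which is $x_\alpha(y)$. *)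

(* Defs.v *)
From HB Require Import structures.
From mathcomp Require Import all_boot all_order all_algebra.
From mathcomp Require Import complex.
From mathcomp Require Import all_classical all_reals all_analysis.

Set Implicit Arguments.
Unset Strict Implicit.
Unset Printing Implicit Defensive.

Import Order.TTheory GRing.Theory Num.Theory.
Import numFieldNormedType.Exports.

Local Open Scope classical_set_scope.
Local Open Scope ring_scope.

(* The scalar field of a Banach space is R or C: [scal R false] is R and
   [scal R true] is R[i]. *)
Definition scal (R : realType) (c : bool) : numFieldType :=
  if c then (R[i] : numFieldType) else (R : numFieldType).

Notation Cplx R := (scal R true).

Section scalars.
Context {R : realType}.

Definition emb (c : bool) : R -> scal R c :=
  if c as c0 return R -> scal R c0 then fun x : R => Complex x 0
  else fun x : R => x.

Definition sre (c : bool) : scal R c -> R :=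
  if c as c0 return scal R c0 -> R then fun z : R[i] => complex.Re z
  else fun x : R => x.

Definition sconj (c : bool) : scal R c -> scal R c :=
  if c as c0 return scal R c0 -> scal R c0 then fun z : R[i] => conjc z
  else fun x : R => x.

Definition sC (c : bool) : scal R c -> Cplx R :=
  if c as c0 return scal R c0 -> Cplx R then fun z : R[i] => z
  else fun x : R => Complex x 0.

Definition ci : Cplx R := Complex 0 1 : R[i].

Definition cmod (z : Cplx R) : R := sre `|z|.

Definition cis (phi : R) : Cplx R := emb true (cos phi) + ci * emb true (sin phi).

Definition cexp (z : Cplx R) : Cplx R :=
  emb true (expR (complex.Re (z : R[i]))) * cis (complex.Im (z : R[i])).

Definition sector (theta : R) : set (Cplx R) :=
  [set z | exists r phi : R,
     [/\ 0 < r, `|phi| < theta & z = emb true r * cis phi]].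

End scalars.
Arguments emb {R c}.
Arguments sre {R c}.
Arguments sconj {R c}.
Arguments sC {R c}.
Arguments ci {R}.

(* MathComp-Analysis norms take values in the scalar field. *)
Definition nrm (R : realType) (c : bool) (X : normedModType (scal R c)) (x : X)
  : R := sre `|x|.

Section scalar_lemmas.
Context {R : realType} {c : bool}.
Local Notation K := (scal R c).

Lemma embD (a b : R) : emb (a + b) = emb a + emb b :> K.
Proof. by case: c => //=; rewrite -[RHS]/(Complex _ _) addr0. Qed.

Lemma embM (a b : R) : emb (a * b) = emb a * emb b :> K.
Proof.
case: c => //=; rewrite -[RHS]/(Complex _ _); congr Complex.
  by rewrite mul0r subr0.
by rewrite mulr0 mul0r addr0.
Qed.

Lemma ler_emb (a b : R) : (emb a <= emb b :> K) = (a <= b).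
Proof.
by case: c => //=; rewrite -[LHS]/((0 == 0) && (a <= b)) eqxx.
Qed.

Lemma emb0 : emb 0 = 0 :> K. Proof. by case: c. Qed.

Lemma ler_sre (x y : K) : x <= y -> sre x <= sre y.
Proof.
case: c x y => //= -[a1 a2] [b1 b2] /= H.
by have /andP[] : (b2 == a2) && (a1 <= b1) := H.
Qed.

Lemma sreK (x : K) : 0 <= x -> emb (sre x) = x.
Proof.
case: c x => //= -[a1 a2] /= H.
have /andP[/eqP <- _] : (a2 == 0) && (0 <= a1) := H.
by [].
Qed.

Lemma sre_norm_ge0 (X : normedModType K) (x : X) : 0 <= nrm x.
Proof.
by rewrite -(ler_emb 0) emb0 /nrm sreK.
Qed.

End scalar_lemmas.

Section dual.
Context {R : realType} {c : bool} (X : normedModType (scal R c)).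
Local Notation K := (scal R c).

Definition dual_pred : {pred X -> K^o} :=
  fun f => `[< linear f /\ continuous f >].

Record dual : Type :=
  Dual { dual_fun :> X -> K^o; dual_funP : dual_fun \in dual_pred }.

HB.instance Definition _ := [isSub for dual_fun].
HB.instance Definition _ := [Choice of dual by <:].

Lemma dual_submod_closed : submod_closed dual_pred.
Proof.
split.
  apply/asboolP; split; first by move=> a x y; rewrite /= scaler0 addr0.
  by move=> x; exact: cvg_cst.
move=> a f g /asboolP[lf cf] /asboolP[lg cg]; apply/asboolP; split.
  move=> k x y; rewrite -![(_ + _) _]/(_ + _) -![(_ *: _) _]/(_ *: _).
  by rewrite lf lg !scalerDr !scalerA [k * a]mulrC addrACA.
move=> x; apply: (@cvgD _ K^o); last exact: cg.
by apply: (@cvgZr _ K^o); exact: cf.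
Qed.

HB.instance Definition _ :=
  GRing.isSubmodClosed.Build K (X -> K^o) dual_pred dual_submod_closed.
HB.instance Definition _ := [SubChoice_isSubLmodule of dual by <:].

Definition dual_norm_set (f : dual) : set R :=
  [set nrm (f x : K^o) | x in [set x : X | nrm x <= 1]].

Definition dual_norm (f : dual) : K := emb (sup (dual_norm_set f)).

Lemma dual_linear (f : dual) : linear f.
Proof. by have /asboolP[] := dual_funP f. Qed.

Lemma dual_continuous (f : dual) : continuous f.
Proof. by have /asboolP[] := dual_funP f. Qed.

Lemma dual_norm_has_sup (f : dual) : has_sup (dual_norm_set f).
Proof.
split.
  exists (nrm (f 0 : K^o)), 0 => //=.
  by rewrite /nrm normr0 -(ler_emb (c := c)) sreK ?emb0 // -[emb 1](_ : 1 = _) //; case: c.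
pose g : {linear X -> K^o} :=
  HB.pack (dual_fun f) (GRing.isLinear.Build K X K^o *%R f (dual_linear f)).
have /linear_boundedP : bounded_near g (nbhs (0 : X)).
  by apply: continuous_linear_bounded; exact: (@dual_continuous f 0).
move=> /pinfty_ex_gt0 [r r0 Hr]; exists (sre r) => _ [x /= x1 <-].
apply: ler_sre; apply: le_trans (Hr x) _.
have x1' : `|x| <= 1.
  rewrite -(sreK (normr_ge0 x)) -[leRHS](_ : emb 1 = _); last by case: c.
  by rewrite ler_emb.
by rewrite ger_pMr.
Qed.

Lemma dual_norm_ub (f : dual) (x : X) : nrm x <= 1 -> `|f x : K^o| <= dual_norm f.
Proof.
move=> x1; rewrite -(sreK (normr_ge0 (f x : K^o))) /dual_norm ler_emb.
by apply: ub_le_sup; [case: (dual_norm_has_sup f)|exists x].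
Qed.

Lemma dual_norm_lub (f : dual) (k : K) : 0 <= k ->
  (forall x, nrm x <= 1 -> `|f x : K^o| <= k) -> dual_norm f <= k.
Proof.
move=> k0 fk; rewrite /dual_norm -(sreK k0) ler_emb.
apply: ge_sup; first by case: (dual_norm_has_sup f).
by move=> _ [x /= x1 <-]; apply: ler_sre; exact: fk.
Qed.

Lemma dual_norm_ge0 (f : dual) : 0 <= dual_norm f.
Proof.
apply: le_trans (dual_norm_ub f (x := 0) _); first exact: normr_ge0.
rewrite /nrm normr0 -(ler_emb (c := c)) sreK ?emb0 //.
by rewrite (_ : emb 1 = 1 :> K) //; case: c.
Qed.

Lemma dual_normD (f g : dual) : dual_norm (f + g) <= dual_norm f + dual_norm g.
Proof.
apply: dual_norm_lub; first by rewrite addr_ge0 // dual_norm_ge0.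
move=> x x1; rewrite -[(f + g) x]/(f x + g x : K^o).
by apply: le_trans (ler_normD _ _) _; rewrite lerD // dual_norm_ub.
Qed.

Lemma dual_normZ (k : K) (f : dual) : dual_norm (k *: f) = `|k| * dual_norm f.
Proof.
have le1 l g : dual_norm (l *: g) <= `|l| * dual_norm g.
  apply: dual_norm_lub; first by rewrite mulr_ge0 // dual_norm_ge0.
  move=> x x1; rewrite -[(l *: g) x]/(l *: (g x : K^o)) normrZ.
  by rewrite ler_wpM2l // dual_norm_ub.
apply/eqP; rewrite eq_le le1 /=; have [->|k0] := eqVneq k 0.
  by rewrite normr0 mul0r dual_norm_ge0.
rewrite -ler_pdivlMl ?normr_gt0 // -normfV.
by apply: le_trans (le1 _ _); rewrite scalerA mulVf // scale1r.
Qed.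

Lemma dual_norm_eq0 (f : dual) : dual_norm f = 0 -> f = 0.
Proof.
move=> f0; apply/val_inj/funext => x /=; rewrite -[RHS]/(0 : K^o).
have Z (a : K) y : f (a *: y) = a * f y.
  have /(_ 0) f00 := dual_linear f 1 0; rewrite !scale1r addr0 in f00.
  have f0z : f 0 = 0 by apply: (addrI (f 0)); rewrite addr0 -f00.
  by have := dual_linear f a y 0; rewrite !addr0 f0z addr0.
have [->|x0] := eqVneq x 0.
  by have := Z 0 0; rewrite scale0r mul0r.
have nx0 : `|x| != 0 by rewrite normr_eq0.
have : `|f (`|x|^-1 *: x) : K^o| <= 0.
  rewrite -f0 dual_norm_ub // /nrm normrZ normfV normr_id mulVf //.
  by case: c.
by rewrite normr_le0 Z mulf_eq0 invr_eq0 (negPf nx0) /= => /eqP.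
Qed.

HB.instance Definition _ :=
  Lmodule_isNormed.Build K dual dual_normD dual_normZ dual_norm_eq0.

End dual.

Section geometry.
Context {R : realType} {c : bool} (X : normedModType (scal R c)).

Definition separable_space : Prop := exists2 S : set X, countable S & dense S.

Definition uniformly_convex : Prop :=
  forall e : R, 0 < e -> exists2 d : R, 0 < d &
    forall x y : X, nrm x = 1 -> nrm y = 1 -> e <= nrm (x - y) ->
      nrm (emb 2^-1 *: (x + y)) <= 1 - d.

Definition reflexive_space : Prop :=
  forall F : dual (dual X), exists x : X, forall f : dual X, F f = f x.

Definition weakly_cvg {T : Type} (g : T -> X) (F : set_system T) (l : X) : Prop :=
  forall phi : dual X, (fun s => phi (g s)) @ F --> phi l.

Definition duality_set (x : X) : set (dual X) :=
  [set f : dual X | (f x = `|x| ^+ 2 :> scal R c) /\ (`|f| ^+ 2 = `|x| ^+ 2)].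

Definition duality_map (x : X) : dual X := xget 0 (duality_set x).

End geometry.

Section bochner.
Context {R : realType} {c : bool} {V : normedModType (scal R c)}.

(* The list [s] stands for the simple function sum_i 1_(A_i) v_i, where
   (A_i, v_i) runs over [s]. *)
Definition simple_fun (s : seq (set R * V)) (x : R) : V :=
  \sum_(p <- s) (emb (\1_(p.1) x) : scal R c) *: p.2.

Definition simple_ok (s : seq (set R * V)) : Prop :=
  forall p, p \in s ->
    measurable p.1 /\ (@lebesgue_measure R p.1 < +oo)%E.

Definition simple_int (D : set R) (s : seq (set R * V)) : V :=
  \sum_(p <- s) (emb (fine (@lebesgue_measure R (p.1 `&` D))) : scal R c) *: p.2.

Definition simple_approx (D : set R) (f : R -> V) (s : nat -> seq (set R * V))
    : Prop :=
  (forall n, simple_ok (s n)) /\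
  {ae @lebesgue_measure R, forall x, D x ->
     (fun n => simple_fun (s n) x) @ \oo --> f x}.

Definition strongly_measurable (D : set R) (f : R -> V) : Prop :=
  exists s, simple_approx D f s.

(* The integrals of the norms are defined even if [f] is only Lebesgue
   measurable; convergence of [s] a.e. is part of [simple_approx]. *)
Definition is_bochner (D : set R) (f : R -> V) (v : V) : Prop :=
  exists s : nat -> seq (set R * V),
    [/\ simple_approx D f s,
        (fun n => \int[@lebesgue_measure R]_(x in D)
           (nrm (f x - simple_fun (s n) x))%:E)%E @ \oo --> 0%E
      & (fun n => simple_int D (s n)) @ \oo --> v].

Definition bochner (D : set R) (f : R -> V) : V := xget 0 (is_bochner D f).

Definition is_vderive (f : R -> V) (t : R) (l : V) : Prop :=
  (fun h : R => (emb h^-1 : scal R c) *: (f (t + h) - f t)) @ 0^' --> l.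

Definition square_integrable (D : set R) (u : R -> V) : Prop :=
  strongly_measurable D u /\
  (\int[@lebesgue_measure R]_(s in D) (nrm (u s) ^+ 2)%:E < +oo)%E.

End bochner.

Definition bounded_op (K : numFieldType) (X Y : normedModType K) (L : X -> Y)
  : Prop := linear L /\ continuous L.

(* Operator with a domain; only the values of [op_fun] on [op_dom] matter. *)
Record operator (X : Type) : Type :=
  Operator { op_dom : set X; op_fun :> X -> X }.

Section operators.
Context {R : realType} {c : bool} {X : normedModType (scal R c)}.
Local Notation K := (scal R c).

Definition subspace (E : set X) : Prop :=
  E 0 /\ forall (k : K) x y, E x -> E y -> E (k *: x + y).

Definition linear_on (E : set X) (F : X -> X) : Prop :=
  forall (k : K) x y, E x -> E y -> F (k *: x + y) = k *: F x + F y.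

Definition closed_op (A : operator X) : Prop :=
  [/\ subspace (op_dom A), linear_on (op_dom A) A
    & closed [set p : X * X | op_dom A p.1 /\ p.2 = A p.1]].

Definition gnrm (A : operator X) (x : X) : R := nrm x + nrm (A x).

(* [F] is a bounded linear operator into [X] from the subspace [E] with
   norm [nu] *)
Definition bounded_on (E : set X) (nu : X -> R) (F : X -> X) : Prop :=
  linear_on E F /\ exists k : R, forall x, E x -> nrm (F x) <= k * nu x.

Definition strongly_continuous (F : R -> X -> X) : Prop :=
  (forall t : R, 0 <= t -> bounded_op (F t)) /\
  (forall x, {within `[0, +oo[, continuous (fun t : R => F t x)}).

End operators.

Section complex_operators.
Context {R : realType} {V : normedModType (Cplx R)}.

(* [F] is analytic on [L] in the norm of the operators from ([E], [nu]) to [V] *)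
Definition analytic_on (L : set (Cplx R)) (E : set V) (nu : V -> R)
    (F : Cplx R -> V -> V) : Prop :=
  forall l, L l -> bounded_on E nu (F l) /\
    exists2 F' : V -> V, bounded_on E nu F' &
      forall e : R, 0 < e -> \forall h \near (0 : Cplx R)^', forall v, E v ->
        nrm (h^-1 *: (F (l + h) v - F l v) - F' v) <= e * nu v.

Definition generates_analytic_semigroup (A : operator V) : Prop :=
  exists (delta : R) (T : Cplx R -> V -> V),
    [/\ 0 < delta <= pi / 2,
        T 0 = idfun /\
        (forall z w, sector delta z -> sector delta w ->
           T (z + w) = T z \o T w),
        analytic_on (sector delta) setT (@nrm R true V) T,
        (forall v, T z v @[z --> within (sector delta) (nbhs (0 : Cplx R))] --> v)
      & forall v w, (op_dom A v /\ A v = w) <->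
          (fun h : R => (emb h^-1 : Cplx R) *: (T (emb h) v - v)) @ 0^'+ --> w].

Definition is_resolvent_at (A : operator V) (l : Cplx R) (S : V -> V) : Prop :=
  [/\ bounded_op S,
      (forall v, op_dom A (S v) /\ l *: S v - A (S v) = v)
    & forall v, op_dom A v -> S (l *: v - A v) = v].

End complex_operators.

(* The complexification of [X]: [X] itself, up to an isometry, if [X] is
   complex, and X + iX with a norm extending that of [X] if [X] is real. *)
Record complexification (R : realType) (c : bool) (X : normedModType (scal R c))
    : Type := Complexification {
  cplx_space :> normedModType (Cplx R);
  cplx_in : X -> cplx_space;
  cplx_re : cplx_space -> X;
  cplx_im : cplx_space -> X;
  cplx_inD : forall x y, cplx_in (x + y) = cplx_in x + cplx_in y;
  cplx_inZ : forall k x, cplx_in (k *: x) = sC k *: cplx_in x;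
  cplx_in_norm : forall x, nrm (cplx_in x) = nrm x;
  cplx_split : forall v, v = cplx_in (cplx_re v) + ci *: cplx_in (cplx_im v);
  cplx_coord : if c then forall v, cplx_im v = 0 else
    forall x y, cplx_re (cplx_in x + ci *: cplx_in y) = x /\
                cplx_im (cplx_in x + ci *: cplx_in y) = y
}.

Section standing_conditions.
Context {R : realType} {c : bool} {X : normedModType (scal R c)}.
Variable XC : complexification X.

Definition cplx_set (E : set X) : set XC :=
  [set v | E (cplx_re v) /\ E (cplx_im v)].

Definition cplx_op (A : operator X) : operator XC :=
  Operator (cplx_set (op_dom A))
    (fun v => cplx_in XC (A (cplx_re v)) + ci *: cplx_in XC (A (cplx_im v))).

(* Bochner integrability is the absolute convergence of the transform. *)
Definition is_laplace (f : R -> X) (l : Cplx R) (w : XC) : Prop :=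
  is_bochner `]0, +oo[
    (fun t => cexp (- (l * emb t)) *: cplx_in XC (f t)) w.

Variables (A : operator X) (G : R -> X -> X) (N : R -> operator X).
Variables (theta a : R) (Ghat Nhat : Cplx R -> XC -> XC).

Local Notation AC := (cplx_op A).

Definition Cd1 : Prop :=
  [/\ generates_analytic_semigroup AC, pi / 2 < theta < pi
    & exists2 M0 : R, 0 < M0 & forall l, sector theta l ->
        exists2 S, is_resolvent_at AC l S &
          forall v, nrm (S v) <= M0 / cmod l * nrm v].

Definition Cd2 : Prop :=
  [/\ strongly_continuous G,
      (forall l z, 0 < sre l -> is_laplace (G ^~ z) l (Ghat l (cplx_in XC z))),
      analytic_on (sector theta) setT (@nrm R true XC) Ghat,
      0 < a /\ (exists2 N0 : R, 0 < N0 & forall l v, sector theta l ->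
        nrm (Ghat l v) <= N0 * cmod l `^ (- a) * nrm v)
    & exists N1 : R, forall l v, sector theta l -> op_dom AC v ->
        nrm (Ghat l v) <= N1 / cmod l * gnrm AC v].

Definition Cd3 : Prop :=
  [/\ (forall t : R, 0 <= t -> op_dom A `<=` op_dom (N t)),
      (forall z, op_dom A z -> strongly_measurable `]0, +oo[ (N ^~ z)),
      (exists beta : R -> R,
        [/\ (forall T : R, 0 <= T ->
               (@lebesgue_measure R).-integrable `[0, T] (EFin \o beta)),
            (forall l : Cplx R, 0 < sre l -> exists w : (Cplx R)^o,
               is_bochner `]0, +oo[
                 (fun t => cexp (- (l * emb t)) * emb (beta t) : (Cplx R)^o) w)
          & forall (t : R) z, 0 < t -> op_dom A z ->
              nrm (N t z) <= beta t * gnrm A z]),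
      (forall l z, 0 < sre l -> op_dom A z ->
         is_laplace (N ^~ z) l (Nhat l (cplx_in XC z))) /\
      analytic_on (sector theta) (op_dom AC) (gnrm AC) Nhat
    & forall e : R, 0 < e -> exists r : R, forall l v, sector theta l ->
        r < cmod l -> op_dom AC v -> nrm (Nhat l v) <= e * gnrm AC v].

Definition Cd4 : Prop :=
  exists (D : set X) (C1 C2 : R),
    [/\ subspace D /\ D `<=` op_dom A,
        (forall x, op_dom A x -> forall e : R, 0 < e ->
           exists2 z, D z & gnrm A (x - z) < e),
        0 < C1 /\ 0 < C2,
        (forall z, D z -> op_dom A (A z))
      & forall l v, sector theta l -> cplx_set D v ->
          [/\ op_dom AC (Nhat l v), op_dom AC (Ghat l v),
              nrm (AC (Nhat l v)) <= C1 * nrm v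
            & gnrm AC (Ghat l v) <= C2 * cmod l `^ (- a) * gnrm AC v]].

End standing_conditions.

Section resolvent_operator.
Context {R : realType} {c : bool} {X : normedModType (scal R c)}.

Definition resolvent_operator (A : operator X) (G : R -> X -> X)
    (N : R -> operator X) (Rs : R -> X -> X) : Prop :=
  [/\ strongly_continuous Rs,
      (exists M w : R, forall (t : R) x, 0 <= t ->
         nrm (Rs t x) <= M * expR (w * t) * nrm x),
      Rs 0 = idfun
    & forall z, op_dom A z ->
      [/\ (forall t : R, 0 <= t -> op_dom A (Rs t z)),
          (* continuity for the graph norm of A *)
          {within `[0, +oo[, continuous (fun t : R => Rs t z)} /\
          {within `[0, +oo[, continuous (fun t : R => A (Rs t z))},
          (exists R' : R -> X, forall t : R, 0 < t ->
             is_vderive (fun s => Rs s z) t (R' t) /\ {for t, continuous R'}),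
          (forall t : R, 0 < t -> is_vderive
             (fun r => Rs r z + bochner `[0, r] (fun s => G (r - s) (Rs s z))) t
             (A (Rs t z) + bochner `[0, t] (fun s => N (t - s) (Rs s z))))
        & (forall t : R, 0 < t -> is_vderive
             (fun r => Rs r z + bochner `[0, r] (fun s => Rs (r - s) (G s z))) t
             (Rs t (A z) + bochner `[0, t] (fun s => Rs (t - s) (N s z))))]].

End resolvent_operator.

(* [dprod F k i] is F_k F_(k-1) ... F_i, and the identity if k < i. *)
Definition dprod (X : Type) (F : nat -> X -> X) (k i : nat) (x : X) : X :=
  foldl (fun y j => F j y) x (index_iota i k.+1).

Section controllability.
Context {R : realType} {c : bool} {X U : normedModType (scal R c)}.
Variables (b : R) (m : nat) (t : nat -> R).

(* A control is a pair (u, (v_1, ..., v_m)); v_k is the entry of index k - 1 of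
   the tuple. *)
Definition control : Type := ((R -> U) * m.-tuple U)%type.

Definition ctrl_op (Rs : R -> X -> X) (B : U -> X) (D : nat -> X -> X)
    (E : nat -> U -> X) (w : control) : X :=
  let v k := nth 0 w.2 k.-1 in
  let step j x := let y := Rs (t j - t j.-1) x in y + D j y in
  let conv p q := bochner `[p, q] (fun s => Rs (q - s) (B (w.1 s))) in
  Rs (b - t m) (\sum_(1 <= i < m.+1)
    dprod step m i.+1
      (let y := conv (t i.-1) (t i) in y + D i y))
  + conv (t m) b
  + Rs (b - t m) (\sum_(2 <= i < m.+1) dprod step m i (E i.-1 (v i.-1)))
  + Rs (b - t m) (E m (v m)).

Definition ctrl_ip (ip : U -> U -> scal R c) (w w' : control) : scal R c :=
  bochner `[0, b] (fun s => ip (w.1 s) (w'.1 s) : (scal R c)^o)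
  + \sum_(k < m) ip (tnth w.2 k) (tnth w'.2 k).

(* L^2([0, b]; U) is represented by functions rather than by classes: the first
   component of [Ms f] is determined almost everywhere only. With U identified
   with its dual through [ip], [Ms] is conjugate-linear for complex scalars. *)
Definition is_adjoint (ip : U -> U -> scal R c) (M : control -> X)
    (Ms : dual X -> control) : Prop :=
  forall f : dual X, square_integrable `[0, b] (Ms f).1 /\
    forall w : control, square_integrable `[0, b] w.1 ->
      f (M w) = ctrl_ip ip w (Ms f).

End controllability.
Arguments control {R c} U m.

(* alpha (alpha I + P J)^-1 y, where [P] maps the dual of [X] to [X] *)
Definition xalpha (R : realType) (c : bool) (X : normedModType (scal R c))
    (P : dual X -> X) (alpha : R) (y : X) : X :=
  (emb alpha : scal R c) *:
  xget 0 [set z : X | (emb alpha : scal R c) *: z + P (duality_map z) = y].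

(* Main.v *)
From HB Require Import structures.
Require Import Defs.
From mathcomp Require Import all_boot all_order all_algebra.
From mathcomp Require Import complex.
From mathcomp Require Import all_classical all_reals all_analysis.
From mathcomp Require Import measurable_realfun ring lra.

Set Implicit Arguments.
Unset Strict Implicit.
Unset Printing Implicit Defensive.

Import Order.TTheory GRing.Theory Num.Theory.
Import numFieldNormedType.Exports.

Local Open Scope classical_set_scope.
Local Open Scope ring_scope.

(**
The form (f, g) |-> <f, MM* g> is Hermitian and positive semidefinite, because
it is the inner product of M* g and M* f.  For alpha > 0 the equation
alpha z + MM* J z = y is the Euler equation of the functional
f |-> alpha |f|^2 / 2 + <f, MM* f> / 2 - Re <f, y> on the dual space: uniform
convexity makes minimizing sequences Cauchy, and z = (y - MM* f) / alpha is a
solution with J z = f when f is the minimizer.  With x = x_alpha(y) this gives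
alpha <g, x> + <g, MM* J x> = alpha <g, y> for all g, whence |x|^2 <= <J x, y>
and <J x, MM* J x> <= alpha |y|^2.

- (i) => (ii): by the Cauchy-Schwarz inequality J x -> 0 on the range of MM*,
  which is dense by (i) and the Hahn-Banach theorem, and |J x| <= |y|.
- (ii) => (iii): |x|^2 <= <J x, y>.
- (iii) => (i): if <f, MM* f> = 0 then <f, MM* g> = 0 for all g, so
  <f, y> = <f, x> -> 0 for all y.
*)

(** * Real and complex scalars treated uniformly: real part, modulus, conjugation *)

Section scalar_theory.
Context {R : realType} {c : bool}.
Local Notation K := (scal R c).

Lemma emb1 : emb 1 = 1 :> K. Proof. by case: c. Qed.

Lemma embN (r : R) : emb (- r) = - emb r :> K.
Proof. by apply/eqP; rewrite -addr_eq0 -embD addNr emb0. Qed.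

Lemma embK (r : R) : sre (emb r : K) = r. Proof. by case: c. Qed.

Lemma ltr_emb (r s : R) : (emb r < emb s :> K) = (r < s).
Proof. by rewrite !lt_neqAle ler_emb (can_eq embK). Qed.

Lemma sreD (z w : K) : sre (z + w) = sre z + sre w.
Proof. by case: c z w => //= -[? ?] [? ?]. Qed.

Lemma sre_emb (r : R) (z : K) : sre (emb r * z) = r * sre z.
Proof. by case: c z => //= -[x y] /=; rewrite mul0r subr0. Qed.

Lemma sre0 : sre (0 : K) = 0. Proof. by rewrite -emb0 embK. Qed.

Lemma sreN (z : K) : sre (- z) = - sre z.
Proof. by apply/eqP; rewrite -addr_eq0 -sreD addNr sre0. Qed.

Lemma sreB (z w : K) : sre (z - w) = sre z - sre w.
Proof. by rewrite sreD sreN. Qed.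

Lemma ltr_sre (z w : K) : z < w -> sre z < sre w.
Proof.
case: c z w => //= -[a1 a2] [b1 b2] /= H.
by have /andP[] : (b2 == a2) && (a1 < b1) := H.
Qed.

Lemma sre_le_norm (z : K) : sre z <= sre `|z|.
Proof.
case: c z => [|z]; last exact: ler_norm.
suff Re_le (z : R[i]) : complex.Re z <= complex.Re `|z| by exact: Re_le.
case: z => x y; rewrite normc_def /= (le_trans (ler_norm x)) // -sqrtr_sqr.
by rewrite ler_sqrt ?lerDl ?addr_ge0 // sqr_ge0.
Qed.

Lemma normr_sre (z : K) : `|sre z| <= sre `|z|.
Proof.
by rewrite ler_norml sre_le_norm andbT lerNl -sreN -normrN sre_le_norm.
Qed.

(** In the complex case |z|^2 = x^2 + y^2 leaves no room for an imaginary part. *)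
Lemma norm_le_sre (z : K) : sre `|z| <= sre z -> z = emb (sre z).
Proof.
case: c z => // z; suff real_z (w : R[i]) :
      complex.Re `|w| <= complex.Re w -> w = Complex (complex.Re w) 0.
  exact: real_z.
case: w => x y; rewrite normc_def /= => xy; congr Complex.
have x0 : 0 <= x by apply: le_trans xy; exact: sqrtr_ge0.
apply/eqP; rewrite -sqrf_eq0; apply/eqP/le_anti; rewrite sqr_ge0 andbT.
rewrite -(lerD2l (x ^+ 2)) addr0 -[leLHS]sqr_sqrtr ?addr_ge0 ?sqr_ge0 //.
by rewrite ler_sqr ?nnegrE ?sqrtr_ge0.
Qed.

Lemma sre_mul_norm (z w : K) : sre `|z * w| = sre `|z| * sre `|w|.
Proof. by rewrite normrM -{1}(sreK (normr_ge0 z)) sre_emb. Qed.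

Lemma norm_emb (r : R) : `|emb r : K| = emb `|r|.
Proof.
have [r0|r0] := leP 0 r; first by rewrite !ger0_norm // -emb0 ler_emb.
by rewrite !ltr0_norm ?embN // -emb0 ltr_emb.
Qed.

(** Rotating by this phase turns bounds on real parts into bounds on moduli. *)
Lemma phaseP (z : K) : exists2 k : K, `|k| = 1 & k * z = `|z|.
Proof.
have [->|z0] := eqVneq z 0; first by exists 1; rewrite ?normr1 // mulr0 normr0.
exists (`|z| / z); last by rewrite mulfVK.
by rewrite normrM normfV normr_id mulfV // normr_eq0.
Qed.

(** The scalar is [ci] in the complex case, where Re (i z) = - Im z, and 0 in the real case. Limits
    of real parts then control limits of moduli. *)
Lemma norm_le_parts : exists k : K,
  forall z, sre `|z| <= `|sre z| + `|sre (k * z)|.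
Proof.
case: c; last by exists 0 => z /=; rewrite mul0r normr0 addr0.
exists ci; suff le_parts (z : R[i]) : complex.Re `|z| <=
    `|complex.Re z| + `|complex.Re (Complex 0 1 * z : R[i])| by exact: le_parts.
case: z => x y; rewrite normc_def /= mul0r mul1r sub0r normrN.
rewrite -[leRHS]ger0_norm ?addr_ge0 // -sqrtr_sqr ler_sqrt ?sqr_ge0 //.
rewrite sqrrD !real_normK ?num_real // addrAC lerDl mulrn_wge0 //.
Qed.

Lemma sconjD (z w : K) : sconj (z + w) = sconj z + sconj w.
Proof. by case: c z w => //=; exact: rmorphD. Qed.

Lemma sconjM (z w : K) : sconj (z * w) = sconj z * sconj w.
Proof. by case: c z w => //=; exact: rmorphM. Qed.

Lemma sconjK : involutive (sconj : K -> K).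
Proof. by case: c => //=; exact: conjcK. Qed.

Lemma sconj_emb (r : R) : sconj (emb r : K) = emb r.
Proof. by case: c => //=; rewrite /conjc oppr0. Qed.

Lemma sconj0 : sconj (0 : K) = 0. Proof. by rewrite -emb0 sconj_emb. Qed.

Lemma sconj_sum I (s : seq I) (F : I -> K) :
  sconj (\sum_(i <- s) F i) = \sum_(i <- s) sconj (F i).
Proof. exact: (big_morph _ sconjD sconj0). Qed.

Lemma norm_sconj (z : K) : `|sconj z| = `|z|.
Proof.
case: c z => // z; suff norm_conjc (w : R[i]) : `|conjc w| = `|w|.
  exact: norm_conjc.
by case: w => x y; rewrite !normc_def /= sqrrN.
Qed.

Lemma sre_conj (z : K) : sre (sconj z) = sre z.
Proof. by case: c z => //= -[]. Qed.

Lemma sconj_real (z : K) : sconj z = z -> z = emb (sre z).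
Proof.
case: c z => //= -[x y] /= [] /eqP.
by rewrite eq_sym -addr_eq0 -mulr2n mulrn_eq0 /= => /eqP ->.
Qed.

(** With k a phase of z - w, equality of the real parts says |z - w| = 0. *)
Lemma sre_inj (z w : K) : (forall k : K, sre (k * z) = sre (k * w)) -> z = w.
Proof.
move=> zw; apply/eqP; rewrite -subr_eq0 -normr_eq0.
have [k _ kz] := phaseP (z - w).
by rewrite -kz -[k * _]sreK ?kz // -kz mulrBr sreB zw subrr emb0.
Qed.

End scalar_theory.

(** * Real-valued norms and elementary estimates for functionals *)

Section norm_theory.
Context {R : realType} {c : bool} {X : normedModType (scal R c)}.
Local Notation K := (scal R c).
Implicit Types (x y : X) (f g : dual X).

Lemma norm_nrm x : `|x| = emb (nrm x). Proof. by rewrite /nrm sreK. Qed.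

Lemma nrm0 : nrm (0 : X) = 0. Proof. by rewrite /nrm normr0 sre0. Qed.

Lemma nrm0_eq0 x : nrm x = 0 -> x = 0.
Proof. by move=> x0; apply/eqP; rewrite -normr_eq0 norm_nrm x0 emb0. Qed.

Lemma nrm_triangle x y : nrm (x + y) <= nrm x + nrm y.
Proof. by rewrite /nrm -sreD; apply/ler_sre/ler_normD. Qed.

Lemma nrmZ (k : K) x : nrm (k *: x) = sre `|k| * nrm x.
Proof. by rewrite /nrm normrZ -{1}(sreK (normr_ge0 k)) sre_emb. Qed.

Lemma nrm_embZ (r : R) x : nrm ((emb r : K) *: x) = `|r| * nrm x.
Proof. by rewrite nrmZ norm_emb embK. Qed.

Lemma nrmN x : nrm (- x) = nrm x. Proof. by rewrite /nrm normrN. Qed.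

Lemma nrm_distC x y : nrm (x - y) = nrm (y - x).
Proof. by rewrite -nrmN opprB. Qed.

Lemma nrm_distD z x y : nrm (x - y) <= nrm (x - z) + nrm (z - y).
Proof. by rewrite -[x - y](subrKA z) nrm_triangle. Qed.

(** Transfers limits from norms valued in the scalar field to the real-valued [nrm]. *)
Lemma nrm_cvg0P {T : Type} {F : set_system T} {FF : Filter F} (g : T -> X) :
  g @ F --> (0 : X) <-> (fun s => nrm (g s)) @ F --> (0 : R).
Proof.
split.
  move=> /cvgr0Pnorm_lt g0; apply/cvgr0Pnorm_lt => e e0.
  near=> s; rewrite ger0_norm ?sre_norm_ge0 // -(ltr_emb (c := c)) -norm_nrm.
  by near: s; apply: g0; rewrite -emb0 ltr_emb.
move=> /cvgr0Pnorm_lt g0; apply/cvgr0Pnorm_lt => e e0.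
rewrite -(sreK (ltW e0)); near=> s; rewrite norm_nrm ltr_emb.
apply: le_lt_trans (ler_norm _) _; near: s; apply: g0.
by rewrite -(sre0 (c := c)); exact: ltr_sre.
Unshelve. all: by end_near. Qed.

Lemma dualD f x y : f (x + y) = f x + f y.
Proof. by have := dual_linear f 1 x y; rewrite !scale1r. Qed.

Lemma dual0 f : f 0 = 0.
Proof. by apply: (addrI (f 0)); rewrite -dualD !addr0. Qed.

Lemma dualZ f (k : K) x : f (k *: x) = k * f x.
Proof. by have := dual_linear f k x 0; rewrite !addr0 dual0 addr0. Qed.

Lemma dualB f x y : f (x - y) = f x - f y.
Proof. by rewrite dualD -scaleN1r dualZ mulN1r. Qed.

Lemma dual_addE f g x : (f + g) x = f x + g x :> K. Proof. by []. Qed.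

Lemma dual_0E x : (0 : dual X) x = 0 :> K. Proof. by []. Qed.

Lemma dual_scaleE (k : K) f x : (k *: f) x = k * f x :> K. Proof. by []. Qed.

Lemma dual_oppE f x : (- f) x = - f x :> K.
Proof. by rewrite -scaleN1r dual_scaleE mulN1r. Qed.

Lemma dual_subE f g x : (f - g) x = f x - g x :> K.
Proof. by rewrite dual_addE dual_oppE. Qed.

Lemma dual_ext f g : (forall x, sre (f x) = sre (g x)) -> f = g.
Proof.
move=> fg; apply/val_inj/funext => x /=; apply: sre_inj => k.
by rewrite -!dualZ fg.
Qed.

Lemma dual_normE f : nrm f = sup (dual_norm_set f).
Proof. by rewrite /nrm -[`|f|]/(dual_norm f) embK. Qed.

Lemma dual_bound f x : sre `|f x : K| <= nrm f * nrm x.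
Proof.
have [x0|x0] := eqVneq (nrm x) 0.
  by rewrite x0 (nrm0_eq0 x0) dual0 normr0 sre0 mulr0.
have nx0 : 0 < nrm x by rewrite lt_def x0 sre_norm_ge0.
rewrite -ler_pdivrMr // dual_normE; apply: ub_le_sup.
  by case: (dual_norm_has_sup f).
exists ((emb (nrm x)^-1 : K) *: x) => /=.
  by rewrite nrm_embZ gtr0_norm ?invr_gt0 // mulVf.
rewrite dualZ [LHS]sre_mul_norm norm_emb embK gtr0_norm ?invr_gt0 //.
exact: mulrC.
Qed.

Lemma dual_re_bound f x : sre (f x) <= nrm f * nrm x.
Proof. exact: le_trans (sre_le_norm _) (dual_bound f x). Qed.

(** Multiplying x by a phase of f(x) makes f(x) equal to its modulus, so real parts suffice. *)
Lemma nrm_dual_le f (C : R) : 0 <= C ->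
  (forall x, sre (f x) <= C * nrm x) -> nrm f <= C.
Proof.
move=> C0 fC; rewrite dual_normE; apply: ge_sup.
  by case: (dual_norm_has_sup f).
move=> _ [x /= x1 <-]; rewrite /nrm.
have [k k1 kf] := phaseP (f x).
rewrite -[`|_|]/(`|f x : K|) -kf -dualZ; apply: le_trans (fC _) _.
by rewrite nrmZ k1 -emb1 embK mul1r ler_piMr.
Qed.

End norm_theory.

(** * The Hahn-Banach theorem through minimal sublinear functionals *)

Section hahn_banach.
Context {R : realType} {V : lmodType R}.
Implicit Types (p q : V -> R) (x y a : V).

Definition sublinear q : Prop :=
  (forall x y, q (x + y) <= q x + q y) /\
  (forall t x, 0 <= t -> q (t *: x) <= t * q x).

Lemma sublinear_ge0N q x : sublinear q -> - q (- x) <= q x.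
Proof.
move=> [qD qZ]; have := qD x (- x); have := qD 0 0.
by rewrite addr0 subrr; lra.
Qed.

Lemma sublinearZ q t x : sublinear q -> 0 <= t -> q (t *: x) = t * q x.
Proof.
move=> [qD qZ]; rewrite le_eqVlt => /predU1P[<-|t0].
  have := qZ 0 0 (lexx 0); have := qD 0 0; rewrite addr0 !scale0r !mul0r; lra.
apply/le_anti; rewrite (qZ _ _ (ltW t0)) /= mulrC -ler_pdivlMr // mulrC.
have := qZ t^-1 (t *: x); rewrite scalerA mulVf ?scale1r ?gt_eqF //.
by apply; rewrite invr_ge0 (ltW t0).
Qed.

(** For sublinear [q], this is the largest sublinear functional below [q] whose value at [- a] is at
    most [- q a]. *)
Definition tilt q a x : R := inf [set q (x + t *: a) - t * q a | t in `[0, +oo[].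

Lemma tilt_le q a x t : sublinear q -> 0 <= t ->
  tilt q a x <= q (x + t *: a) - t * q a.
Proof.
move=> sq t0; apply: ge_inf; last first.
  by exists t; rewrite //= in_itv /= t0.
exists (- q (- x)) => _ [s /= + <-]; rewrite in_itv /= andbT => s0.
have [qD _] := sq; have := qD (x + s *: a) (- x).
by rewrite addrAC subrr add0r (sublinearZ _ sq s0); lra.
Qed.

Lemma le_tilt q a x r :
  (forall t, 0 <= t -> r <= q (x + t *: a) - t * q a) -> r <= tilt q a x.
Proof.
move=> rq; apply: lb_le_inf.
  by exists (q (x + 0 *: a) - 0 * q a), 0; rewrite //= in_itv /= lexx.
by move=> _ [s /= + <-]; rewrite in_itv /= andbT => /rq.
Qed.

Lemma tilt_id_le q a x : sublinear q -> tilt q a x <= q x.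
Proof.
by move=> sq; have := tilt_le a x sq (lexx 0); rewrite scale0r addr0 mul0r subr0.
Qed.

Lemma tiltN q a : sublinear q -> tilt q a (- a) <= - q a.
Proof.
move=> sq; have := tilt_le a (- a) sq ler01.
by rewrite scale1r addNr -(scale0r a) (sublinearZ _ sq) // !mul0r mul1r sub0r.
Qed.

(** Parameters s for x and t for y combine to s + t for x + y; scaling by t > 0 rescales the
    parameter. *)
Lemma tilt_sublinear q a : sublinear q -> sublinear (tilt q a).
Proof.
move=> sq; have [qD qZ] := sq; split=> [x y|t x].
  rewrite -lerBlDr; apply: le_tilt => s s0.
  rewrite lerBlDr -lerBlDl; apply: le_tilt => t t0; rewrite lerBlDl.
  apply: le_trans (tilt_le _ _ sq (addr_ge0 s0 t0)) _.
  have := qD (x + s *: a) (y + t *: a).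
  by rewrite addrACA -scalerDl; lra.
rewrite le_eqVlt => /predU1P[<-|t0].
  rewrite scale0r mul0r; apply: le_trans (tilt_id_le _ _ sq) _.
  by rewrite -(scale0r a) (sublinearZ _ sq) // mul0r.
rewrite -ler_pdivrMl //; apply: le_tilt => s s0; rewrite ler_pdivrMl //.
apply: le_trans (tilt_le _ _ sq (mulr_ge0 (ltW t0) s0)) _.
by rewrite -scalerA -scalerDr (sublinearZ _ sq (ltW t0)); lra.
Qed.

(** Zorn's lemma: a nonempty chain has its pointwise infimum as a bound, finite because every
    sublinear q <= p satisfies - p (- x) <= q x. *)
Lemma minimal_sublinear p : sublinear p ->
  exists2 q, sublinear q /\ (forall x, q x <= p x) &
    forall q', sublinear q' -> (forall x, q' x <= q x) -> forall x, q x <= q' x.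
Proof.
move=> sp; pose T := {q | sublinear q /\ forall x, q x <= p x}.
have pT : sublinear p /\ forall x, p x <= p x by [].
(* The order is reversed, so that a maximal element is a minimal functional. *)
pose le (q r : T) := `[< forall x, sval r x <= sval q x >].
have [|||q qmin] := @ZL_preorder T (exist _ p pT) le.
- by move=> q; apply/asboolP.
- move=> r s t /asboolP sr /asboolP ts; apply/asboolP => x.
  exact: le_trans (ts x) (sr x).
- move=> A Atot; have [A0|/set0P[q0 Aq0]] := eqVneq A set0.
    by exists (exist _ p pT) => s; rewrite A0.
  pose E x := [set sval q x | q in A].
  have lbE x : has_lbound (E x).
    exists (- p (- x)) => _ [[q /= [sq qp]] _ <-].
    by apply: le_trans _ (sublinear_ge0N x sq); rewrite lerN2.
  have Ele x (q : T) : A q -> inf (E x) <= sval q x.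
    by move=> Aq; apply: ge_inf => //; exists q.
  have leE x r : (forall q : T, A q -> r <= sval q x) -> r <= inf (E x).
    move=> rq; apply: lb_le_inf; first by exists (sval q0 x), q0.
    by move=> _ [q Aq <-]; exact: rq.
  have sE : sublinear (fun x => inf (E x)).
    split=> [x y|t x].
      rewrite -lerBlDr; apply: (leE) => q Aq.
      rewrite lerBlDr -lerBlDl; apply: (leE) => r Ar; rewrite lerBlDl.
      (* Of two members of the chain, the smaller one serves both arguments. *)
      have [/asboolP qr|/asboolP rq] := Atot _ _ Aq Ar.
        apply: le_trans (Ele _ _ Ar) _.
        by apply: le_trans ((svalP r).1.1 x y) _; rewrite lerD2r.
      apply: le_trans (Ele _ _ Aq) _.
      by apply: le_trans ((svalP q).1.1 x y) _; rewrite lerD2l.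
    rewrite le_eqVlt => /predU1P[<-|t0].
      rewrite scale0r mul0r; apply: le_trans (Ele _ _ Aq0) _.
      by rewrite -(scale0r x) (sublinearZ _ (svalP q0).1) // mul0r.
    rewrite -ler_pdivrMl //; apply: (leE) => q Aq; rewrite ler_pdivrMl //.
    apply: le_trans (Ele _ _ Aq) _.
    by rewrite (sublinearZ _ (svalP q).1 (ltW t0)).
  have Ep : sublinear (fun x => inf (E x)) /\ forall x, inf (E x) <= p x.
    by split=> // x; apply: le_trans (Ele _ _ Aq0) ((svalP q0).2 x).
  exists (exist _ (fun x => inf (E x)) Ep : T) => q Aq.
  by apply/asboolP => x; exact: Ele.
exists (sval q); first exact: (svalP q).
move=> r sr rq; have rp x : r x <= p x := le_trans (rq x) ((svalP q).2 x).
have le_qr : le q (exist _ r (conj sr rp)) by apply/asboolP.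
by have /asboolP := qmin _ le_qr.
Qed.

(* A minimal sublinear functional is linear since it is not above its tilts. *)
Lemma sublinear_support p x0 : sublinear p ->
  exists F : V -> R, [/\ {morph F : x y / x + y},
    forall t x, F (t *: x) = t * F x, forall x, F x <= p x & F x0 = p x0].
Proof.
(* Starting below the tilt of [p] at [x0] forces q (- x0) <= - p x0, which becomes equality at [x0]
   once [q] is linear. *)
move=> sp; have [q [sq qp] qmin] := minimal_sublinear (tilt_sublinear x0 sp).
have qN a : q (- a) = - q a.
  have := qmin _ (tilt_sublinear a sq) (fun x => tilt_id_le a x sq) (- a).
  have := tiltN a sq; have := sublinear_ge0N (- a) sq; rewrite opprK; lra.
have qp' x : q x <= p x := le_trans (qp x) (tilt_id_le x0 x sp).
exists q; split=> //.
- move=> x y; have := sq.1 x y; have := sq.1 (x + y) (- y).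
  by rewrite addrK qN; lra.
- move=> t x; have [t0|t0] := leP 0 t; first exact: sublinearZ.
  rewrite -[t]opprK scaleNr qN (sublinearZ _ sq) ?mulNr //.
  by rewrite oppr_ge0 (ltW t0).
- apply: le_anti; rewrite qp' /= -lerN2 -qN.
  exact: le_trans (qp _) (tiltN x0 sp).
Qed.

End hahn_banach.

(** * Restriction of scalars to the reals *)

Section realification.
Context {R : realType} {c : bool}.

(** An alias of [X], keeping the real module structure apart from the one over [scal R c]. *)
Definition realified (X : lmodType (scal R c)) : Type := X.

Variable X : lmodType (scal R c).

HB.instance Definition _ := GRing.Zmodule.on (realified X).

Definition real_scale (r : R) (x : realified X) : realified X :=
  (emb r : scal R c) *: (x : X).

Lemma real_scaleA r s x : real_scale r (real_scale s x) = real_scale (r * s) x.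
Proof. by rewrite /real_scale scalerA embM. Qed.

Lemma real_scale1 : left_id 1 real_scale.
Proof. by move=> x; rewrite /real_scale emb1 scale1r. Qed.

Lemma real_scaleDr : right_distributive real_scale +%R.
Proof. by move=> r x y; rewrite /real_scale -scalerDr. Qed.

Lemma real_scaleDl x : {morph real_scale^~ x : r s / r + s}.
Proof. by move=> r s; rewrite /real_scale embD scalerDl. Qed.

HB.instance Definition _ := GRing.Zmodule_isLmodule.Build R (realified X)
  real_scaleA real_scale1 real_scaleDr real_scaleDl.

End realification.

(** * Bounded functionals recovered from their real parts *)

Section functionals.
Context {R : realType} {c : bool} {X : normedModType (scal R c)}.
Local Notation K := (scal R c).

Lemma dual_of_re (F : X -> K^o) (C : R) : linear F ->
  (forall x, sre (F x) <= C * nrm x) -> exists f : dual X, forall x, f x = F x.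
Proof.
move=> lF FC.
pose G : {linear X -> K^o} := HB.pack F (GRing.isLinear.Build K X K^o *%R F lF).
have FZ k x : F (k *: x) = k * F x by exact: (linearZ_LR G).
have FC' x : sre `|F x : K| <= C * nrm x.
  have [k k1 kF] := phaseP (F x); rewrite -kF -FZ; apply: le_trans (FC _) _.
  by rewrite nrmZ k1 -emb1 embK mul1r.
suff cF : F \in @dual_pred R c X by exists (@Dual _ _ _ F cF).
apply/asboolP; split=> //.
apply: (@bounded_linear_continuous _ _ _ G); apply/linear_boundedP.
have rC : (emb C : K) \is Num.real.
  by rewrite realE -!emb0 !ler_emb le_total.
near=> r => x.
apply: (@le_trans _ _ (emb C * `|x|)).
  rewrite norm_nrm [X in _ <= _ * X]norm_nrm -embM ler_emb; exact: FC'.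
by rewrite ler_wpM2r //; near: r; exact: nbhs_pinfty_ge.
Unshelve. all: by end_near. Qed.

End functionals.

(** In the complex case the functional is F x = r x - i r (i x); real linearity of r makes it
    complex linear. *)
Lemma dual_of_real {R : realType} {c : bool} {X : normedModType (scal R c)}
    (r : X -> R) (C : R) :
  {morph r : x y / x + y} ->
  (forall (a : R) x, r ((emb a : scal R c) *: x) = a * r x) ->
  (forall x, r x <= C * nrm x) -> exists f : dual X, forall x, sre (f x) = r x.
Proof.
case: c X r => X r rD rZ rC; last first.
  have [|//|f fr] := @dual_of_re R false X r C; last by exists f.
  by move=> k x y; rewrite rD rZ.
pose F x : (scal R true)^o := Complex (r x) (- r (ci *: x)) : R[i].
have [|//|f fF] := @dual_of_re R true X F C; last by exists f => x; rewrite fF.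
move=> [a b] x y.
have E : (Complex a b : scal R true) = emb a + emb b * ci.
  apply: (etrans
    (y := Complex (a + (b * 0 - 0 * 1)) (0 + (b * 1 + 0 * 0)) : R[i])).
    by congr Complex; ring.
  by [].
have EE : ci * (emb a + emb b * ci) = emb a * ci - emb b :> scal R true.
  rewrite mulrDr mulrCA -{2}[emb b]mulr1 -mulrN mulrC; congr (_ + _ * _).
  rewrite -emb1 -embN.
  apply: (etrans (y := Complex (0 * 0 - 1 * 1) (0 * 1 + 1 * 0) : R[i])) => //.
  by congr Complex; ring.
have rk : r ((Complex a b : scal R true) *: x) = a * r x + b * r (ci *: x).
  by rewrite E scalerDl -scalerA rD !rZ.
have rik : r (ci *: ((Complex a b : scal R true) *: x))
    = a * r (ci *: x) - b * r x.
  by rewrite scalerA E EE scalerBl -scaleNr -embN -scalerA rD !rZ mulNr.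
rewrite /F scalerDr !rD rk rik.
apply: (etrans (y := Complex (a * r x - b * (- r (ci *: x)) + r y)
   (a * (- r (ci *: x)) + b * r x - r (ci *: y)) : R[i])) => //.
by congr Complex; ring.
Qed.

(** * Supporting functionals and a density criterion *)

Section separation.
Context {R : realType} {c : bool} {X : normedModType (scal R c)}.
Local Notation K := (scal R c).

Lemma seminorm_support (p : X -> R) (C : R) (x0 : X) :
  (forall x y, p (x + y) <= p x + p y) ->
  (forall (r : R) x, 0 <= r -> p ((emb r : K) *: x) <= r * p x) ->
  (forall x, p x <= C * nrm x) ->
  exists2 f : dual X, forall x, sre (f x) <= p x & sre (f x0) = p x0.
Proof.
move=> pD pZ pC.
have [F [FD FZ Fp Fx0]] : exists F : X -> R, [/\ {morph F : x y / x + y},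
    forall (r : R) x, F ((emb r : K) *: x) = r * F x, forall x, F x <= p x
    & F x0 = p x0].
  exact: (@sublinear_support R (realified X) p x0 (conj pD pZ)).
have [f fF] := dual_of_real FD FZ (fun x => le_trans (Fp x) (pC x)).
by exists f => [x|]; rewrite fF.
Qed.

Lemma norming_functional (x0 : X) :
  exists2 f : dual X, nrm f <= 1 & sre (f x0) = nrm x0.
Proof.
have [|r x r0|x|f fx fx0] := @seminorm_support (@nrm R c X) 1 x0.
- exact: nrm_triangle.
- by rewrite nrm_embZ ger0_norm.
- by rewrite mul1r.
by exists f => //; apply: nrm_dual_le => // x; rewrite mul1r.
Qed.

(** The distance p to S is sublinear, so some f has Re f <= p and Re f(x) = p(x). As p vanishes on S
    = - S, so does Re f; hence f = 0 and p(x) = 0. *)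
Lemma dense_of_annihilator (S : set X) : S 0 ->
  (forall x y, S x -> S y -> S (x + y)) ->
  (forall (r : R) x, S x -> S ((emb r : K) *: x)) ->
  (forall f : dual X, (forall x, S x -> sre (f x) = 0) -> f = 0) ->
  forall (x : X) (e : R), 0 < e -> exists2 y, S y & nrm (x - y) < e.
Proof.
move=> S0 SD SZ S_ann x e e0.
pose p z := inf [set nrm (z - y) | y in S].
have lb z : has_lbound [set nrm (z - y) | y in S].
  by exists 0 => _ [y _ <-]; exact: sre_norm_ge0.
have p_le z y : S y -> p z <= nrm (z - y).
  by move=> Sy; apply: ge_inf => //; exists y.
have le_p z r : (forall y, S y -> r <= nrm (z - y)) -> r <= p z.
  move=> rS; apply: lb_le_inf; first by exists (nrm (z - 0)), 0.
  by move=> _ [y Sy <-]; exact: rS.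
have p_nrm z : p z <= 1 * nrm z.
  by rewrite mul1r -[in leRHS](subr0 z); exact: p_le.
have [|r z r0|//|f fp fx] := @seminorm_support p 1 x.
- move=> y z; rewrite -lerBlDr; apply: (le_p) => v Sv.
  rewrite lerBlDr -lerBlDl; apply: (le_p) => w Sw; rewrite lerBlDl.
  apply: le_trans (p_le _ _ (SD _ _ Sv Sw)) _.
  by rewrite opprD addrACA nrm_triangle.
- move: r0; rewrite le_eqVlt => /predU1P[<-|r0].
    by apply: le_trans (p_nrm _) _; rewrite emb0 scale0r nrm0 mulr0 mul0r.
  rewrite -ler_pdivrMl //; apply: (le_p) => v Sv; rewrite ler_pdivrMl //.
  apply: le_trans (p_le _ _ (SZ r v Sv)) _.
  by rewrite -scalerBr nrm_embZ gtr0_norm.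
have px : p x < e.
  have f_ge z : S z -> 0 <= sre (f z).
    move=> Sz; have := fp (- z); rewrite -scaleN1r dualZ mulN1r sreN scaleN1r.
    have := p_le (- z) ((emb (-1) : K) *: z) (SZ _ _ Sz).
    by rewrite embN emb1 scaleN1r subrr nrm0; lra.
  suff f0 : f = 0 by rewrite -fx f0 -[(0 : dual X) x]/(0 : K) sre0.
  apply: S_ann => z Sz; apply/le_anti; rewrite f_ge // andbT.
  by have := p_le z z Sz; have := fp z; rewrite subrr nrm0; lra.
apply: contrapT => nS; move: px; apply/negP; rewrite -leNgt; apply: le_p => y Sy.
by rewrite leNgt; apply/negP => xy; apply: nS; exists y.
Qed.

End separation.

(** * Uniform convexity for vectors of different norms *)

Section uniform_convexity.
Context {R : realType} {c : bool} {Y : normedModType (scal R c)}.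
Local Notation K := (scal R c).

(** A small convexity defect of the squared norm makes the two norms close. Either both vectors are
    small, or they can be normalized and compared on the unit sphere. *)
Lemma uniformly_convex_midpoint (C e : R) : uniformly_convex Y -> 0 < e ->
  exists2 s : R, 0 < s & forall f g : Y, nrm f <= C -> nrm g <= C ->
    nrm f ^+ 2 / 2 + nrm g ^+ 2 / 2 - (nrm (f + g) / 2) ^+ 2 < s ^+ 2 ->
    nrm (f - g) <= e.
Proof.
move=> ucY e0.
have [C0|C0] := leP C 0.
  exists 1 => // f g fC gC _; apply: le_trans (nrm_triangle f (- g)) _.
  by rewrite nrmN; lra.
have [d0 d0_gt0 ucd] := ucY (e / (2 * C)) ltac:(by rewrite divr_gt0 ?mulr_gt0).
pose d := Num.min d0 1.
have d_gt0 : 0 < d by rewrite lt_min d0_gt0 ltr01.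
have d_le1 : d <= 1 by rewrite ge_min lexx orbT.
have d_le : d <= d0 by rewrite ge_min lexx.
(* The divisor 20 gives 5 s = (e / 4) d, which is below a d as soon as a > e / 4. *)
exists (e * d / 20); first by rewrite divr_gt0 ?mulr_gt0.
move=> f g fC gC; set s := e * d / 20; set a := nrm f; set b := nrm g.
move=> sfg.
have s0 : 0 < s by rewrite divr_gt0 ?mulr_gt0.
have s_le : s <= e / 20 by rewrite ler_pM2r // ger_pMr.
have a0 : 0 <= a by exact: sre_norm_ge0.
have b0 : 0 <= b by exact: sre_norm_ge0.
have fg0 : 0 <= nrm (f + g) by exact: sre_norm_ge0.
have fgab : nrm (f + g) <= a + b by exact: nrm_triangle.
(* The defect dominates a^2 / 2 + b^2 / 2 - ((a + b) / 2)^2 = ((a - b) / 2)^2. *)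
have ab : `|a - b| < 2 * s.
  have s2 : 0 <= 2 * s by lra.
  rewrite -(ltr_pXn2r (n := 2)) ?nnegrE ?normr_ge0 //.
  rewrite real_normK ?num_real //.
  have : (nrm (f + g) / 2) ^+ 2 <= ((a + b) / 2) ^+ 2.
    by rewrite ler_pXn2r ?nnegrE //; lra.
  move: sfg; rewrite -/a -/b !expr2; nra.
have [ae|ea] := leP a (e / 4).
  apply: le_trans (nrm_triangle f (- g)) _; rewrite nrmN -/a -/b.
  move: ab; rewrite ltr_norml => /andP[]; lra.
have a_gt0 : 0 < a by lra.
have b_gt0 : 0 < b by move: ab; rewrite ltr_norml => /andP[]; lra.
rewrite leNgt; apply/negP => efg.
pose f1 : Y := (emb a^-1 : K) *: f; pose g1 : Y := (emb b^-1 : K) *: g.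
have f1E : f = (emb a : K) *: f1.
  by rewrite scalerA -embM divff ?gt_eqF // emb1 scale1r.
have g1E : g = (emb b : K) *: g1.
  by rewrite scalerA -embM divff ?gt_eqF // emb1 scale1r.
have nf1 : nrm f1 = 1 by rewrite nrm_embZ gtr0_norm ?invr_gt0 // mulVf ?gt_eqF.
have ng1 : nrm g1 = 1 by rewrite nrm_embZ gtr0_norm ?invr_gt0 // mulVf ?gt_eqF.
(* Giving [g1] the same coefficient a as [f1] costs only |a - b|. *)
have gE : g = (emb a : K) *: g1 + (emb (b - a) : K) *: g1.
  by rewrite -scalerDl -embD subrKC.
have nba : nrm ((emb (b - a) : K) *: g1) = `|a - b|.
  by rewrite nrm_embZ ng1 mulr1 distrC.
have far : e / (2 * C) <= nrm (f1 - g1).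
  rewrite ler_pdivrMr ?mulr_gt0 //.
  have : nrm (f - g) <= a * nrm (f1 - g1) + `|a - b|.
    rewrite -nba -[in X in X * _](gtr0_norm a_gt0) -nrm_embZ.
    rewrite {1}f1E {1}gE opprD addrA -scalerBr -(nrmN ((emb (b - a) : K) *: g1)).
    exact: nrm_triangle.
  have : a * nrm (f1 - g1) <= C * nrm (f1 - g1).
    by rewrite ler_wpM2r // sre_norm_ge0.
  lra.
have mid := ucd f1 g1 nf1 ng1 far.
have : nrm (f + g) / 2 <= a * (1 - d) + s.
  have : nrm (f + g) <= a * (2 * (1 - d0)) + `|a - b|.
    rewrite -nba {1}f1E {1}gE addrA -scalerDr.
    apply: le_trans (nrm_triangle _ _) _; rewrite lerD2r nrm_embZ gtr0_norm //.
    by move: mid; rewrite nrm_embZ gtr0_norm ?invr_gt0 // ler_pM2l //; lra.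
  have : a * (1 - d0) <= a * (1 - d) by rewrite ler_wpM2l // lerD2l lerN2.
  lra.
move=> fg_le.
have : (nrm (f + g) / 2) ^+ 2 <= (a * (1 - d) + s) ^+ 2.
  by rewrite ler_pXn2r ?nnegrE //; nra.
have : (a - s) ^+ 2 <= ((a + b) / 2) ^+ 2.
  have /andP[ab1 ab2] : - (2 * s) < a - b < 2 * s by rewrite -ltr_norml.
  by rewrite ler_pXn2r ?nnegrE //; lra.
(* The defect is at least (a - s)^2 - (a (1 - d) + s)^2 = (a d - 2 s) (2 a - a d), which exceeds s^2
   because a d > 5 s and d <= 1. *)
have ad : 5 * s < a * d.
  have : e / 4 * d < a * d by rewrite ltr_pM2r.
  by rewrite /s; lra.
have : 5 * s * a < a * d * a by rewrite ltr_pM2r.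
move: sfg; rewrite -/a -/b !expr2.
have : 0 <= a * a * d * (1 - d) by rewrite !mulr_ge0 // ?(ltW d_gt0) // subr_ge0.
have : s * s <= s * a by rewrite ler_pM2l //; lra.
have : 0 <= a * d * s by rewrite !mulr_ge0 // ltW.
nra.
Qed.

End uniform_convexity.

(** * Monotonicity of the lower integral *)

Section lower_integral.
Local Open Scope ereal_scope.
Context d (T : measurableType d) (R : realType) (mu : {measure set T -> \bar R}).

(* Measurability is not assumed: a Bochner integrand is Borel only up to a null
   set, and the integral of a nonnegative function is then a lower integral. *)
Lemma le_lower_integral (A B : set T) (f g : T -> \bar R) :
  A `<=` B -> (forall x, A x -> 0 <= f x) -> (forall x, B x -> 0 <= g x) ->
  (forall x, A x -> f x <= g x) ->
  \int[mu]_(x in A) f x <= \int[mu]_(x in B) g x.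
Proof.
move=> AB f0 g0 fg; rewrite !ge0_integralE //; apply: le_ereal_sup.
move=> _ [h /= hf <-]; exists h => //= x; apply: le_trans (hf x) _.
rewrite !patchE; case: ifPn => xA.
  by rewrite (mem_set (AB _ (set_mem xA))) fg //; exact: set_mem.
by case: ifPn => // /set_mem/g0.
Qed.

End lower_integral.

(** * Uniqueness of the Bochner integral *)

Section bochner_theory.
Context {R : realType} {c : bool} {V : normedModType (scal R c)}.
Local Notation K := (scal R c).
Local Notation mu := (@lebesgue_measure R).
Implicit Types (s : seq (set R * V)) (D : set R) (f : R -> V) (v w : V).

Lemma nrm_cvg {T : Type} {F : set_system T} {FF : Filter F} (g : T -> V) v :
  g @ F --> v -> (fun x => nrm (g x)) @ F --> nrm v.
Proof.
move=> /subr_cvg0/nrm_cvg0P/cvgr0Pnorm_lt g0; apply/cvgrPdist_lt => e e0; near=> x.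
apply: (@le_lt_trans _ _ `|nrm (g x - v)|); last by near: x; exact: g0.
rewrite (ger0_norm (sre_norm_ge0 _)) ler_norml.
have := nrm_triangle (g x - v) v; have := nrm_triangle (v - g x) (g x).
rewrite !subrK nrm_distC; lra.
Unshelve. all: by end_near. Qed.

Lemma simple_fun_cons (p : set R * V) s x :
  simple_fun (p :: s) x = (emb (\1_(p.1) x) : K) *: p.2 + simple_fun s x.
Proof. by rewrite /simple_fun big_cons. Qed.

Lemma simple_ok_cons (p : set R * V) s : simple_ok (p :: s) ->
  [/\ measurable p.1, (mu p.1 < +oo)%E & simple_ok s].
Proof.
move=> ok; have [mp fp] := ok p (mem_head _ _); split=> // q qs.
by apply: ok; rewrite inE qs orbT.
Qed.

(** A simple function takes finitely many values on measurable pieces, so any [h] is allowed; the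
    induction absorbs the head vector into [h]. *)
Lemma measurable_simple_fun s (h : V -> R) : simple_ok s ->
  measurable_fun setT (fun x => h (simple_fun s x)).
Proof.
elim: s h => [|p s IH] h ok.
  by rewrite /simple_fun; under eq_fun do rewrite big_nil; exact: measurable_cst.
have [mp _ oks] := simple_ok_cons ok.
have -> : (fun x => h (simple_fun (p :: s) x)) = (fun x =>
    \1_(p.1) x * h (p.2 + simple_fun s x)
    + (1 - \1_(p.1) x) * h (simple_fun s x)).
  apply/funext => x; rewrite simple_fun_cons indicE; case: (x \in p.1) => /=.
    by rewrite emb1 scale1r mul1r subrr mul0r addr0.
  by rewrite emb0 scale0r add0r subr0 mul0r mul1r add0r.
apply: measurable_funD; apply: measurable_funM.
- exact: measurable_indic.
- exact: (IH (fun v => h (p.2 + v))).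
- by apply: measurable_funB => //; exact: measurable_indic.
- exact: IH.
Qed.

Lemma simple_fun_cat s s' x :
  simple_fun (s ++ s') x = simple_fun s x + simple_fun s' x.
Proof. exact: big_cat. Qed.

Lemma simple_int_cat D s s' :
  simple_int D (s ++ s') = simple_int D s + simple_int D s'.
Proof. exact: big_cat. Qed.

Definition simple_opp s : seq (set R * V) := [seq (p.1, - p.2) | p <- s].

Lemma simple_fun_opp s x : simple_fun (simple_opp s) x = - simple_fun s x.
Proof.
by rewrite /simple_fun big_map -sumrN; apply: eq_bigr => p _; rewrite scalerN.
Qed.

Lemma simple_int_opp D s : simple_int D (simple_opp s) = - simple_int D s.
Proof.
by rewrite /simple_int big_map -sumrN; apply: eq_bigr => p _; rewrite scalerN.
Qed.

Lemma simple_ok_subr s s' : simple_ok s -> simple_ok s' ->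
  simple_ok (s ++ simple_opp s').
Proof.
move=> oks oks' p; rewrite mem_cat => /orP[/oks//|/mapP[q /oks' ? ->]] //.
Qed.

Section real_functional.
Variables (D : set R) (l : V -> R).
Hypothesis mD : measurable D.
Hypothesis lD : {morph l : x y / x + y}.
Hypothesis lZ : forall (r : R) x, l ((emb r : K) *: x) = r * l x.

(** Real-linear functionals reduce integrals of vector-valued simple functions to Lebesgue
    integrals. *)
Lemma simple_int_functional s : simple_ok s ->
  mu.-integrable D (fun x => (l (simple_fun s x))%:E) /\
  (\int[mu]_(x in D) (l (simple_fun s x))%:E = (l (simple_int D s))%:E)%E.
Proof.
have l0 : l 0 = 0 by have := lZ 0 0; rewrite scaler0 mul0r.
elim: s => [|p s IH] ok.
  rewrite /simple_int /simple_fun; under eq_fun do rewrite big_nil l0.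
  by rewrite big_nil l0; split; [exact: integrable0|exact: integral0].
have [mp fp oks] := simple_ok_cons ok; have [is_ Is] := IH oks.
have fpD : (mu (p.1 `&` D) < +oo)%E.
  apply: le_lt_trans fp; apply: le_measure => //.
  - by rewrite inE; exact: measurableI.
  - by rewrite inE.
have ip : mu.-integrable D (fun x => (\1_(p.1) x)%:E).
  apply/integrableP; split; first exact/measurable_EFinP/measurable_indic.
  under eq_integral do rewrite gee0_abs ?lee_fin //.
  by rewrite integral_indic.
have E : (fun x => (l (simple_fun (p :: s) x))%:E) =
    (fun x => (l p.2)%:E * (\1_(p.1) x)%:E + (l (simple_fun s x))%:E)%E.
  by apply/funext => x; rewrite simple_fun_cons lD lZ EFinD EFinM muleC.
have ilp : mu.-integrable D (fun x => ((l p.2)%:E * (\1_(p.1) x)%:E)%E).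
  exact: integrableZl.
have fin : (mu (p.1 `&` D) \is a fin_num)%E.
  by rewrite ge0_fin_numE.
rewrite E; split; first exact: integrableD.
rewrite integralD // Is integralZl // integral_indic //.
by rewrite /simple_int big_cons lD lZ EFinD EFinM fineK // muleC.
Qed.

End real_functional.

Lemma nrm_simple_int D s : measurable D -> simple_ok s ->
  ((nrm (simple_int D s))%:E <= \int[mu]_(x in D) (nrm (simple_fun s x))%:E)%E.
Proof.
move=> mD ok; have [f f1 fs] := norming_functional (simple_int D s).
have [|r x|if_ If] := @simple_int_functional D (fun v => sre (f v)) mD _ _ s ok.
- by move=> x y; rewrite dualD sreD.
- by rewrite dualZ sre_emb.
rewrite -fs -If; apply: le_trans (_ : _ <= `|_|)%E _; first exact: lee_abs.
apply: le_trans (le_abse_integral _ _ _) _ => //; first exact: measurable_int if_.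
apply: le_lower_integral => // x _; rewrite lee_fin ?sre_norm_ge0 //.
have := dual_re_bound f (simple_fun s x).
have := dual_re_bound f (- simple_fun s x).
rewrite nrmN -scaleN1r dualZ mulN1r sreN.
have : nrm f * nrm (simple_fun s x) <= nrm (simple_fun s x).
  by rewrite ler_piMl ?sre_norm_ge0.
by rewrite ler_norml; lra.
Qed.

(** The integrals of two approximating simple functions differ by at most the sum of their errors
    against f, which tends to 0. *)
Lemma is_bochner_unique D f v w : measurable D ->
  is_bochner D f v -> is_bochner D f w -> v = w.
Proof.
move=> mD [s [[oks sf] s0 sv]] [s' [[oks' sf'] s0' sw]].
have [N [mN N0 Nf]] := sf.
have fN x : (D `\` N) x -> (fun n => simple_fun (s n) x) @ \oo --> f x.
  by move=> [Dx Nx]; apply: contrapT => nf; apply: Nx; apply: Nf => /(_ Dx).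
pose err (r : nat -> seq (set R * V)) n :=
  (\int[mu]_(x in D) (nrm (f x - simple_fun (r n) x))%:E)%E.
(* Off the null set [N] the error is a pointwise limit of norms of simple functions, hence
   measurable. Splitting the integral of a sum of errors relies on this. *)
have m_err (r : nat -> seq (set R * V)) n : simple_ok (r n) ->
    measurable_fun (D `\` N) (fun x => nrm (f x - simple_fun (r n) x)).
  move=> okr.
  apply: (measurable_fun_cvg
    (h := fun k x => nrm (simple_fun (s k ++ simple_opp (r n)) x))).
  - move=> k; apply: measurable_funTS; apply: measurable_simple_fun.
    exact: simple_ok_subr.
  - move=> x /fN fx; under eq_fun do rewrite simple_fun_cat simple_fun_opp.
    by apply: nrm_cvg; apply: cvgB => //; exact: cvg_cst.
have le_err n :
    ((nrm (simple_int D (s n) - simple_int D (s' n)))%:E <= err s n + err s' n)%E.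
  have okn : simple_ok (s n ++ simple_opp (s' n)) by exact: simple_ok_subr.
  rewrite -simple_int_opp -simple_int_cat; apply: le_trans (nrm_simple_int mD okn) _.
  have mDN : measurable (D `\` N) by exact: measurableD.
  rewrite (ge0_negligible_integral mN mD) //; first last.
  - by move=> x _; rewrite lee_fin sre_norm_ge0.
  - apply/measurable_EFinP/measurable_funTS; exact: measurable_simple_fun.
  apply: (@le_trans _ _ (\int[mu]_(x in D `\` N)
      ((nrm (f x - simple_fun (s n) x))%:E
       + (nrm (f x - simple_fun (s' n) x))%:E))%E).
    apply: le_lower_integral => // x _; rewrite ?adde_ge0 ?lee_fin ?sre_norm_ge0 //.
    rewrite simple_fun_cat simple_fun_opp.
    by rewrite (nrm_distC (f x) (simple_fun (s n) x)) nrm_distD.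
  have e0 (r : nat -> seq (set R * V)) x :
      (0 <= (nrm (f x - simple_fun (r n) x))%:E)%E by rewrite lee_fin sre_norm_ge0.
  have m_err' r : simple_ok (r n) -> measurable_fun (D `\` N)
      (fun x => (nrm (f x - simple_fun (r n) x))%:E).
    by move=> okr; apply/measurable_EFinP; exact: (m_err r n okr).
  rewrite ge0_integralD //; [|exact: m_err' (oks n)|exact: m_err' (oks' n)].
  by apply: leeD; apply: le_lower_integral => // x _; rewrite lee_fin sre_norm_ge0.
have vw : (fun n => simple_int D (s n) - simple_int D (s' n)) @ \oo --> v - w.
  exact: cvgB.
have n0 :
    (fun n => nrm (simple_int D (s n) - simple_int D (s' n))) @ \oo --> (0 : R).
  suff /fine_cvgP[_] : ((fun n =>
      (nrm (simple_int D (s n) - simple_int D (s' n)))%:E) @ \oo --> 0%:E)%E by [].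
  apply: (@squeeze_cvge _ _ _ _ (fun=> 0%E) _ (fun n => err s n + err s' n)%E).
  - by near=> n; rewrite le_err andbT lee_fin sre_norm_ge0.
  - exact: cvg_cst.
  - rewrite (_ : 0%:E%E = (0 + 0)%E :> \bar R); last by rewrite adde0.
    exact: cvgeD.
apply/eqP; rewrite -subr_eq0; apply/eqP.
by move/nrm_cvg0P in n0; exact: cvg_unique vw n0.
Unshelve. all: by end_near. Qed.

Lemma bochnerP D f v : measurable D -> is_bochner D f v -> bochner D f = v.
Proof.
move=> mD fv; apply: (@is_bochner_unique D f) => //.
by apply: (@xgetPex _ 0 (is_bochner D f)); exists v.
Qed.

End bochner_theory.

(** * Bochner integrals under real-linear isometries *)

Section bochner_isometry.
Context {R : realType} {c : bool} {V W : normedModType (scal R c)}.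
Local Notation K := (scal R c).
Variable T : V -> W.
Hypothesis TD : {morph T : x y / x + y}.
Hypothesis TZ : forall (r : R) x, T ((emb r : K) *: x) = (emb r : K) *: T x.
Hypothesis T_nrm : forall x, nrm (T x) = nrm x.

Let T0 : T 0 = 0.
Proof. by have := TZ 0 0; rewrite emb0 !scale0r. Qed.

Let TB x y : T (x - y) = T x - T y.
Proof. by rewrite TD -[- y]scaleN1r -emb1 -embN TZ embN emb1 scaleN1r. Qed.

Lemma isometry_cvg {I : Type} {F : set_system I} {FF : Filter F} (g : I -> V) v :
  g @ F --> v -> (fun i => T (g i)) @ F --> T v.
Proof.
move=> /subr_cvg0/nrm_cvg0P g0; apply/subr_cvg0/nrm_cvg0P.
by under eq_fun do rewrite -TB T_nrm.
Qed.

(** Applying T to the values of the simple functions leaves all errors unchanged. Real linearity is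
    the right generality for complex conjugation. *)
Lemma is_bochner_isometry (D : set R) (f : R -> V) v :
  is_bochner D f v -> is_bochner D (T \o f) (T v).
Proof.
move=> [s [[oks sf] s0 sv]].
pose s' n : seq (set R * W) := [seq (p.1, T p.2) | p <- s n].
have s'E n x : simple_fun (s' n) x = T (simple_fun (s n) x).
  rewrite /simple_fun big_map (big_morph T TD T0).
  by apply: eq_bigr => p _; rewrite TZ.
have s'I n : simple_int D (s' n) = T (simple_int D (s n)).
  rewrite /simple_int big_map (big_morph T TD T0).
  by apply: eq_bigr => p _; rewrite TZ.
exists s'; split.
- split=> [n p /mapP[q /oks ? ->] //|].
  have [N [mN N0 Nf]] := sf; exists N; split=> // x nTx; apply: Nf => sfx.
  apply: nTx => Dx; under eq_fun do rewrite s'E.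
  exact/isometry_cvg/sfx.
- suff -> : (fun n => \int[@lebesgue_measure R]_(x in D)
       (nrm ((T \o f) x - simple_fun (s' n) x))%:E)%E =
    (fun n => \int[@lebesgue_measure R]_(x in D)
       (nrm (f x - simple_fun (s n) x))%:E)%E by [].
  apply/funext => n; apply: eq_integral => x _.
  by rewrite /= s'E -TB T_nrm.
- by under eq_fun do rewrite s'I; exact: isometry_cvg.
Qed.

End bochner_isometry.

(** * Conjugation and positivity of scalar Bochner integrals *)

Section scalar_bochner.
Context {R : realType} {c : bool}.
Local Notation K := (scal R c).
Local Notation mu := (@lebesgue_measure R).
Variable D : set R.
Hypothesis mD : measurable D.

Lemma sre_cvg {I : Type} {F : set_system I} {FF : Filter F} (g : I -> K^o)
    (z : K^o) :
  g @ F --> z -> (fun i => sre (g i : K)) @ F --> sre (z : K).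
Proof.
move=> /subr_cvg0/nrm_cvg0P/cvgr0Pnorm_lt g0; apply/cvgrPdist_lt => e e0; near=> i.
apply: (@le_lt_trans _ _ `|nrm (g i - z)|); last by near: i; exact: g0.
rewrite (ger0_norm (sre_norm_ge0 _)) distrC -sreB; exact: normr_sre.
Unshelve. all: by end_near. Qed.

Lemma is_bochner_conj (f : R -> K^o) (v : K^o) :
  is_bochner D f v -> is_bochner D (fun x => sconj (f x) : K^o) (sconj v : K^o).
Proof.
apply: (is_bochner_isometry (T := fun z : K^o => sconj z : K^o)).
- exact: sconjD.
- by move=> r x; rewrite [LHS]sconjM sconj_emb.
- by move=> x; rewrite /nrm [`|_|]norm_sconj.
Qed.

(** Conjugation is an involution, so both sides are integrable together; otherwise both take the
    default value 0. *)
Lemma bochner_conj (f : R -> K^o) :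
  bochner D (fun x => sconj (f x) : K^o) = sconj (bochner D f) :> K.
Proof.
have [[v fv]|nf] := pselect (exists v, is_bochner D f v).
  by rewrite (bochnerP mD fv); apply: bochnerP => //; exact: is_bochner_conj.
rewrite /bochner !xgetPN ?sconj0 //.
- by move=> v fv; apply: nf; exists v.
- move=> v /is_bochner_conj fv; apply: nf; exists (sconj v).
  suff -> : f = (fun x => sconj (sconj (f x)) : K^o) by [].
  by apply/funext => x; rewrite sconjK.
Qed.

(** The integral is real by invariance under conjugation. As f >= 0, the negative part of an
    approximating simple function is at most its error, so the limit of the integrals is
    nonnegative. *)
Lemma bochner_ge0 (f : R -> K^o) (r : R -> R) :
  (forall x, f x = emb (r x)) -> (forall x, 0 <= r x) -> 0 <= (bochner D f : K).
Proof.
move=> fr r0; have fC : (fun x => sconj (f x) : K^o) = f.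
  by apply/funext => x; rewrite fr sconj_emb.
have := bochner_conj f; rewrite fC => /esym/sconj_real ->; rewrite -emb0 ler_emb.
have [[v fv]|nf] := pselect (exists v, is_bochner D f v); last first.
  by rewrite /bochner xgetPN ?sre0 // => v fv; apply: nf; exists v.
rewrite (bochnerP mD fv); case: fv => s [[oks _] s0 sv].
have le_s n : ((- sre (simple_int D (s n)))%:E <=
    \int[mu]_(x in D) (nrm (f x - simple_fun (s n) x))%:E)%E.
  have [|a x|si sI] := @simple_int_functional R c _ D
    (fun z : K^o => - sre z) mD _ _ _ (oks n).
  - by move=> x y; rewrite sreD opprD.
  - by rewrite sre_emb mulrN.
  rewrite -sI integralE.
  apply: (@le_trans _ _ (\int[mu]_(x in D)
    ((fun x => (- sre (simple_fun (s n) x))%:E)^\+ x))%E).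
    by rewrite -[leRHS]sube0; apply: leeB => //; exact: integral_ge0.
  apply: le_lower_integral => // x _; first by rewrite lee_fin sre_norm_ge0.
  rewrite funeposE ge_max !lee_fin sre_norm_ge0 andbT.
  apply: le_trans (sre_le_norm (f x - simple_fun (s n) x)).
  by rewrite sreB fr embK lerDr.
have /fine_cvgP[fin err0] := s0.
rewrite -oppr_le0; apply: ler_cvg_to (cvgN (sre_cvg sv)) err0 _.
near=> n; rewrite -lee_fin /= fineK; first exact: le_s.
by near: n.
Unshelve. all: by end_near. Qed.

End scalar_bochner.

(** * The duality mapping *)

Section duality_mapping.
Context {R : realType} {c : bool} {X : normedModType (scal R c)}.
Local Notation K := (scal R c).
Implicit Types (x : X) (f g : dual X).

(** All terms of |x|^2 <= Re f(x) <= |f(x)| <= |f| |x| <= |x|^2 are equal, and then f(x) is real. *)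
Lemma duality_set_intro x f :
  nrm f <= nrm x -> nrm x ^+ 2 <= sre (f x) -> duality_set x f.
Proof.
move=> fx xf; have := dual_bound f x; have := sre_le_norm (f x).
have x0 : 0 <= nrm x by exact: sre_norm_ge0.
have f0 : 0 <= nrm f by exact: sre_norm_ge0.
move: xf; rewrite expr2 => xf fx1 fx2.
have E : nrm f = nrm x.
  apply/le_anti; rewrite fx /=; have [->//|x1] := eqVneq (nrm x) 0.
  have x_gt0 : 0 < nrm x by rewrite lt_def x1.
  by rewrite -(ler_pM2r x_gt0); lra.
split; last by rewrite !norm_nrm E.
have fE : sre (f x) = nrm x * nrm x by rewrite E in fx2; lra.
have -> : f x = emb (sre (f x)) :> K.
  by apply: norm_le_sre; rewrite fE -{1}E.
by rewrite fE embM -norm_nrm expr2.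
Qed.

Lemma duality_set_elim x f : duality_set x f ->
  nrm f = nrm x /\ sre (f x) = nrm x ^+ 2.
Proof.
move=> [fx f2]; split; last by rewrite fx norm_nrm expr2 -embM embK expr2.
apply/eqP; rewrite -(@eqrXn2 _ 2) ?sre_norm_ge0 //; apply/eqP.
by move/(congr1 sre): f2; rewrite !norm_nrm !expr2 -!embM !embK.
Qed.

Lemma duality_set_nonempty x : exists f : dual X, duality_set x f.
Proof.
have [f f1 fx] := norming_functional x; have x0 := sre_norm_ge0 x.
exists ((emb (nrm x) : K) *: f); apply: duality_set_intro.
  by rewrite nrm_embZ ger0_norm // ler_piMr.
by rewrite dual_scaleE sre_emb fx expr2.
Qed.

Lemma duality_map_set x : duality_set x (duality_map x).
Proof. exact: xgetPex (duality_set_nonempty x). Qed.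

Lemma nrm_duality_map x : nrm (duality_map x) = nrm x.
Proof. by have [] := duality_set_elim (duality_map_set x). Qed.

Lemma duality_map_self x : sre (duality_map x x) = nrm x ^+ 2.
Proof. by have [] := duality_set_elim (duality_map_set x). Qed.

Hypothesis ucX : uniformly_convex (dual X).

(** For f and g in the duality set, evaluation at x shows that (f + g) / 2 has norm at least |x|;
    the convexity defect is then at most 0. *)
Lemma duality_map_unique x f : duality_set x f -> duality_map x = f.
Proof.
move=> Jf; have [fx fxx] := duality_set_elim Jf; set g := duality_map x.
apply/eqP; rewrite -subr_eq0; apply/eqP/nrm0_eq0/le_anti.
rewrite sre_norm_ge0 andbT; apply/ler_addgt0Pr => e e0; rewrite add0r.
have [s s0 sP] := uniformly_convex_midpoint (nrm x) ucX e0.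
apply: sP; rewrite ?nrm_duality_map ?fx //.
apply: le_lt_trans (_ : _ <= 0) _; last by rewrite exprn_gt0.
have gf := dual_re_bound (g + f) x.
rewrite dual_addE sreD fxx duality_map_self in gf.
have x0 := sre_norm_ge0 x; have gf0 := sre_norm_ge0 (g + f).
have : nrm x <= nrm (g + f) / 2.
  have [->|x1] := eqVneq (nrm x) 0; first by rewrite divr_ge0.
  have x_gt0 : 0 < nrm x by rewrite lt_def x1.
  by rewrite -(ler_pM2r x_gt0); rewrite expr2 in gf; lra.
by rewrite -(ler_pXn2r (n := 2)) ?nnegrE ?divr_ge0 //; lra.
Qed.

Lemma duality_mapZ (r : R) x : 0 < r ->
  duality_map ((emb r : K) *: x) = (emb r : K) *: duality_map x.
Proof.
move=> r0; apply: duality_map_unique; apply: duality_set_intro.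
  by rewrite !nrm_embZ nrm_duality_map.
rewrite dual_scaleE dualZ !sre_emb nrm_embZ duality_map_self gtr0_norm //.
by rewrite exprMn expr2 mulrA.
Qed.

End duality_mapping.

(** * Positive symmetric forms and the Cauchy-Schwarz inequality *)

Section positive_form.
Context {R : realType} {c : bool} {X : normedModType (scal R c)}.
Local Notation K := (scal R c).
Variable P : dual X -> X.
Implicit Types f g h : dual X.

(** Real linearity in [f] is immediate; in [g] it comes from the symmetry [formC], [P] being an
    arbitrary map. *)
Definition form f g : R := sre (f (P g)).

Hypothesis formC : forall f g, form f g = form g f.
Hypothesis form_ge0 : forall f, 0 <= form f f.

Lemma formDl f g h : form (f + g) h = form f h + form g h.
Proof. by rewrite /form dual_addE sreD. Qed.

Lemma formZl (r : R) f g : form ((emb r : K) *: f) g = r * form f g.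
Proof. by rewrite /form dual_scaleE sre_emb. Qed.

Lemma form_line f g (t : R) :
  form (f + (emb t : K) *: g) (f + (emb t : K) *: g) =
  form f f + 2 * t * form f g + t ^+ 2 * form g g.
Proof.
rewrite formDl !(formC _ (_ + _)) !formDl !formZl.
by rewrite (formC _ (_ *: _)) (formC g (_ *: _)) !formZl (formC g f); ring.
Qed.

Lemma form_CS f g : form f g ^+ 2 <= form f f * form g g.
Proof.
have pos t := form_ge0 (f + (emb t : K) *: g).
have [g0|g0] := eqVneq (form g g) 0.
  rewrite g0 mulr0; have [->|fg0] := eqVneq (form f g) 0; first by rewrite expr0n.
  (* At this parameter the form along the line equals -1, a contradiction. *)
  have := pos (- (form f f + 1) / (2 * form f g)); rewrite form_line g0 mulr0 addr0.
  have -> : 2 * (- (form f f + 1) / (2 * form f g)) * form f g = - (form f f + 1).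
    by field; rewrite fg0.
  lra.
have g_gt0 : 0 < form g g by rewrite lt_def g0 form_ge0.
have := pos (- form f g / form g g); rewrite form_line.
have -> : form f f + 2 * (- form f g / form g g) * form f g
    + (- form f g / form g g) ^+ 2 * form g g
    = (form f f * form g g - form f g ^+ 2) / form g g by field.
by rewrite pmulr_lge0 ?invr_gt0 // subr_ge0.
Qed.

(** * Solving z + P J z = y by minimizing a convex functional *)

Section minimization.
Hypothesis ucX : uniformly_convex (dual X).
Variable y : X.

(** The parameter alpha is taken to be 1 here; in general it is absorbed into [P] and [y]. *)
Definition energy f : R := nrm f ^+ 2 / 2 + form f f / 2 - sre (f y).

Lemma energy_ge f : - (nrm y ^+ 2 / 2) <= energy f.
Proof.
have := dual_re_bound f y; have := form_ge0 f; have := sqr_ge0 (nrm f - nrm y).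
by rewrite /energy !expr2; nra.
Qed.

Let m := inf (range energy).

Lemma inf_energy_le f : m <= energy f.
Proof.
apply: ge_inf; last by exists f.
by exists (- (nrm y ^+ 2 / 2)) => _ [g _ <-]; exact: energy_ge.
Qed.

(** Since m <= energy 0 = 0, the energy of f is below 1, whereas |f| > 2 |y| + 2 would give |f|^2 /
    2 - |f| |y| >= |f| > 1. *)
Lemma energy_bounded f : energy f < m + 1 -> nrm f <= 2 * nrm y + 2.
Proof.
have E0 : energy 0 = 0.
  by rewrite /energy /form !dual_0E sre0 nrm0 expr0n /= !mul0r subr0 addr0.
have := inf_energy_le 0; have := dual_re_bound f y; have := form_ge0 f.
have f0 := sre_norm_ge0 f; have y0 := sre_norm_ge0 y.
rewrite E0 /energy => ff fy m0 fm; rewrite leNgt; apply/negP => fbig.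
have : 0 <= (nrm f - (2 * nrm y + 2)) * nrm f by rewrite mulr_ge0 // subr_ge0 ltW.
by move: fm; rewrite expr2; lra.
Qed.

(** The midpoint has energy at least m, the linear terms cancel, and the quadratic terms leave form
    (f - g) (f - g) / 4 >= 0. *)
Lemma energy_midpoint f g :
  nrm f ^+ 2 / 2 + nrm g ^+ 2 / 2 - (nrm (f + g) / 2) ^+ 2 <=
  energy f + energy g - 2 * m.
Proof.
have fg := form_line f g 1; have f_g := form_line f g (-1).
rewrite embN emb1 scaleN1r in f_g; rewrite emb1 scale1r in fg.
have := form_ge0 (f - g); rewrite f_g.
have := inf_energy_le ((emb 2^-1 : K) *: (f + g)).
have -> : energy ((emb 2^-1 : K) *: (f + g)) = (nrm (f + g) / 2) ^+ 2 / 2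
    + form (f + g) (f + g) / 8 - (sre (f y) + sre (g y)) / 2.
  rewrite /energy formZl formC formZl nrm_embZ ger0_norm ?invr_ge0 //.
  by rewrite dual_scaleE sre_emb dual_addE sreD; lra.
by rewrite fg /energy; lra.
Qed.

Lemma energy_near e : 0 < e -> exists2 d : R, 0 < d & forall f g,
  energy f < m + d -> energy g < m + d -> nrm (f - g) <= e.
Proof.
move=> e0; have [s s0 sP] := uniformly_convex_midpoint (2 * nrm y + 2) ucX e0.
exists (Num.min 1 (s ^+ 2 / 2)) => [|f g].
  by rewrite lt_min ltr01 divr_gt0 ?exprn_gt0.
rewrite !addr_minr !lt_min => /andP[f1 fs] /andP[g1 gs].
apply: sP; [exact: energy_bounded|exact: energy_bounded|].
by apply: le_lt_trans (energy_midpoint f g) _; lra.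
Qed.

(** A minimizing sequence is Cauchy; its pointwise limit defines a functional to which it converges
    in norm, and the energy is lower semicontinuous. *)
Lemma energy_minimizer : exists f, forall g, energy f <= energy g.
Proof.
have infE : has_inf (range energy).
  split; first by exists (energy 0), 0.
  by exists (- (nrm y ^+ 2 / 2)) => _ [g _ <-]; exact: energy_ge.
have /choice[f_ f_m] n : exists f, energy f < m + n.+1%:R^-1.
  have [|_ [f _ <-] fm] := inf_adherent (_ : 0 < n.+1%:R^-1) infE.
    by rewrite invr_gt0.
  by exists f.
have f_bd n x : sre (f_ n x) <= (2 * nrm y + 2) * nrm x.
  apply: le_trans (dual_re_bound _ _) _; rewrite ler_wpM2r ?sre_norm_ge0 //.
  apply: energy_bounded; apply: lt_le_trans (f_m n) _.
  by rewrite lerD2l invf_le1 // ler1n.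
have f_near d : 0 < d -> \forall n \near \oo, energy (f_ n) < m + d.
  move=> d0; near=> n; apply: lt_le_trans (f_m n) _; rewrite lerD2l ltW //.
  by near: n; exact: (near_infty_natSinv_lt (PosNum d0)).
have f_cauchy e : 0 < e ->
    \forall n \near \oo, \forall k \near \oo, nrm (f_ n - f_ k) <= e.
  move=> e0; have [d d0 dP] := energy_near e0.
  by near=> n; near=> k; apply: dP; [near: n|near: k]; exact: (f_near _ d0).
have f_cvg x : cvgn (fun n => sre (f_ n x)).
  apply/cauchy_cvgP/cauchy_exP => e e0.
  have e1 : 0 < e / 2 / (nrm x + 1) by rewrite !divr_gt0 // ltr_wpDl ?sre_norm_ge0.
  near \oo => n; exists (sre (f_ n x)).
  suff : \forall k \near \oo, `|sre (f_ n x) - sre (f_ k x)| < e by [].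
  near=> k.
  have fnk : nrm (f_ n - f_ k) <= e / 2 / (nrm x + 1).
    by near: k; near: n; exact: (f_cauchy _ e1).
  have le_e (v : dual X) : nrm v <= e / 2 / (nrm x + 1) -> sre (v x) < e.
    move=> ve; apply: le_lt_trans (dual_re_bound _ _) _.
    move: ve; rewrite ler_pdivlMr ?ltr_wpDl ?sre_norm_ge0 // => ve.
    by have := sre_norm_ge0 v; lra.
  rewrite ltr_norml -sreB -dual_subE le_e // andbT ltrNl -sreN.
  by rewrite -dual_oppE opprB le_e // nrm_distC.
pose r x := limn (fun n => sre (f_ n x)).
have r_bd x : r x <= (2 * nrm y + 2) * nrm x.
  by apply: limr_le => //; near=> n; exact: f_bd.
have [||f fr] := dual_of_real _ _ r_bd.
- move=> x z; apply/cvg_lim => //.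
  under eq_fun do rewrite dualD sreD.
  exact: cvgD.
- move=> a x; apply/cvg_lim => //.
  under eq_fun do rewrite dualZ sre_emb.
  exact: cvgM (cvg_cst a) (f_cvg x).
have f_lim e : 0 < e -> \forall n \near \oo, nrm (f_ n - f) <= e.
  move=> e0; near=> n; apply: nrm_dual_le (ltW e0) _ => x.
  rewrite dual_subE sreB fr lerBlDr -lerBlDl.
  apply: limr_ge => //; near=> k; rewrite lerBlDl -lerBlDr -sreB -dual_subE.
  apply: le_trans (dual_re_bound _ _) _; rewrite ler_wpM2r ?sre_norm_ge0 //.
  by near: k; near: n; exact: (f_cauchy _ e0).
exists f => g; apply: le_trans (inf_energy_le g); apply/ler_addgt0Pr => e e0.
(* The summands bound the change of the squared norm (2 |y| + 2 + 1), of the form (|P f|) and of the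
   linear term (|y|), per unit of distance d <= 1. *)
pose C := 2 * nrm y + 2 + 1 + nrm (P f) + nrm y.
have C0 : 0 < C.
  have := sre_norm_ge0 y; have := sre_norm_ge0 (P f); rewrite /C; lra.
pose d := Num.min 1 (e / (2 * C)).
have d0 : 0 < d by rewrite lt_min ltr01 divr_gt0 ?mulr_gt0.
near \oo => n.
have fnm : energy (f_ n) < m + e / 2 by near: n; apply: (f_near); rewrite divr_gt0.
have fn1 : nrm (f_ n) <= 2 * nrm y + 2.
  by apply: energy_bounded; near: n; exact: (f_near _ ltr01).
have fnf : nrm (f_ n - f) <= d by near: n; exact: (f_lim _ d0).
have d1 : d <= 1 by rewrite ge_min lexx.
have dC : d * C <= e / 2.
  have : d <= e / (2 * C) by rewrite ge_min lexx orbT.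
  by rewrite ler_pdivlMr ?mulr_gt0 //; lra.
have f0 := sre_norm_ge0 f; have fn0 := sre_norm_ge0 (f_ n).
have nf : nrm f <= nrm (f_ n) + d.
  have := nrm_triangle (f - f_ n) (f_ n); rewrite subrK nrm_distC; lra.
have nf2 : nrm f ^+ 2 <= nrm (f_ n) ^+ 2 + 2 * d * (2 * nrm y + 2 + 1).
  apply: le_trans (_ : _ <= (nrm (f_ n) + d) ^+ 2) _.
    by rewrite ler_pXn2r ?nnegrE ?addr_ge0 ?(ltW d0).
  by rewrite !expr2; nra.
have fy : - (d * nrm y) <= sre (f y) - sre (f_ n y).
  have := dual_re_bound (f_ n - f) y; rewrite dual_subE sreB.
  have : nrm (f_ n - f) * nrm y <= d * nrm y by rewrite ler_wpM2r ?sre_norm_ge0.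
  lra.
(* Expanding form (f_n - f) (f_n - f) >= 0 involves [P] only at the fixed point f, so no continuity
   of [P] enters. *)
have ff : form f f - 2 * d * nrm (P f) <= form (f_ n) (f_ n).
  have := form_ge0 (f_ n - f); have := form_line (f_ n) f (-1).
  rewrite embN emb1 scaleN1r => ->.
  have : form f f - form (f_ n) f <= d * nrm (P f).
    have := dual_re_bound (f - f_ n) (P f); rewrite dual_subE sreB nrm_distC.
    have : nrm (f_ n - f) * nrm (P f) <= d * nrm (P f).
      by rewrite ler_wpM2r ?sre_norm_ge0.
    rewrite /form; lra.
  rewrite expr2; lra.
by move: fnm; rewrite /energy; move: dC; rewrite /C; lra.
Unshelve. all: by end_near. Qed.

(* At a minimizer [f], the residual [z = y - P f] satisfies
   [Re h(z) - |h|^2 / 2 <= Re f(z) - |f|^2 / 2] for all [h]; for [h] in the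
   duality set of [z] this is the equality case of Young's inequality. *)
Lemma duality_equation : exists z, z + P (duality_map z) = y.
Proof.
have [f fmin] := energy_minimizer; pose z := y - P f.
suff Jf : duality_set z f by exists z; rewrite (duality_map_unique ucX Jf) subrK.
have [h hJ] := duality_set_nonempty z; have [hn hz] := duality_set_elim hJ.
have f0 := sre_norm_ge0 f; have h0 := sre_norm_ge0 h; have z0 := sre_norm_ge0 z.
(* Compare f with f + t (h - f): convexity of the squared norm bounds the first term, and division
   by t leaves an error linear in t. *)
have key t : 0 < t -> t <= 1 ->
    0 <= nrm h ^+ 2 / 2 - nrm f ^+ 2 / 2 - sre ((h - f) z)
      + t * form (h - f) (h - f).
  move=> t_gt0 t1; have := fmin (f + (emb t : K) *: (h - f)).
  rewrite /energy form_line.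
  have : nrm (f + (emb t : K) *: (h - f)) ^+ 2
      <= (1 - t) * nrm f ^+ 2 + t * nrm h ^+ 2.
    have : nrm (f + (emb t : K) *: (h - f)) <= (1 - t) * nrm f + t * nrm h.
      have -> : f + (emb t : K) *: (h - f) =
          (emb (1 - t) : K) *: f + (emb t : K) *: h.
        by rewrite embD embN emb1 scalerBl scale1r scalerBr addrAC addrA.
      apply: le_trans (nrm_triangle _ _) _.
      rewrite !nrm_embZ !ger0_norm ?subr_ge0 //.
      exact: ltW.
    have : 0 <= (1 - t) * nrm f + t * nrm h.
      by rewrite addr_ge0 ?mulr_ge0 ?subr_ge0 // ltW.
    move=> A0 A1; apply: le_trans (_ : _ <= ((1 - t) * nrm f + t * nrm h) ^+ 2) _.
      by rewrite ler_pXn2r ?nnegrE ?sre_norm_ge0.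
    have : 0 <= t * (1 - t) * (nrm f - nrm h) ^+ 2.
      by rewrite mulr_ge0 ?sqr_ge0 // mulr_ge0 ?subr_ge0 // ltW.
    by rewrite !expr2; lra.
  have -> : sre ((h - f) z) = sre ((h - f) y) - form (h - f) f.
    by rewrite dualB sreB.
  rewrite dual_addE dual_scaleE sreD sre_emb (formC f (h - f)) => n2 mint.
  have : 0 <= t * t * form (h - f) (h - f) by rewrite !mulr_ge0 ?form_ge0 // ltW.
  move=> q; rewrite -(pmulr_rge0 _ t_gt0); rewrite (expr2 t) in mint; lra.
(* Let t tend to 0: t (q + 1) <= e keeps the error below e. *)
have {}key : sre ((h - f) z) <= nrm h ^+ 2 / 2 - nrm f ^+ 2 / 2.
  apply/ler_addgt0Pr => e e0; pose q := form (h - f) (h - f).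
  have q0 : 0 <= q by exact: form_ge0.
  pose t := Num.min 1 (e / (q + 1)).
  have t0 : 0 < t by rewrite lt_min ltr01 divr_gt0 //; lra.
  have t1 : t <= 1 by rewrite ge_min lexx.
  have tq : t * (q + 1) <= e.
    by rewrite -ler_pdivlMr ?ge_min ?lexx ?orbT //; lra.
  by have := key t t0 t1; rewrite -/q; lra.
have fz := dual_re_bound f z.
move: key; rewrite dual_subE sreB hz hn => key.
have fhz : nrm f = nrm z.
  apply/eqP; rewrite -subr_eq0 -sqrf_eq0; apply/eqP/le_anti.
  by rewrite sqr_ge0 andbT; rewrite !expr2 in key *; lra.
by apply: duality_set_intro; rewrite fhz // in key *; lra.
Qed.

End minimization.
End positive_form.

(** * The three convergence and positivity implications for a Hermitian positive map *)

Section gramian.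
Context {R : realType} {c : bool} {X : normedModType (scal R c)}.
Local Notation K := (scal R c).
Variable P : dual X -> X.
Hypothesis P_herm : forall f g : dual X, f (P g) = sconj (g (P f) : K) :> K.
Hypothesis P_ge0 : forall f : dual X, 0 <= f (P f) :> K.
Hypothesis ucX : uniformly_convex (dual X).
Implicit Types (f g : dual X) (x y : X) (r : R).

Let formC f g : form P f g = form P g f.
Proof. by rewrite /form P_herm sre_conj. Qed.

Let form_ge0 f : 0 <= form P f f.
Proof. by rewrite -(sre0 (c := c)); exact: ler_sre. Qed.

Local Notation J r y := (duality_map (xalpha P r y)).

(** The equation r w + P (J w) = y tested against g and multiplied by r, with x = r w and J (r w) =
    r J w. *)
Lemma xalpha_equation r y g : 0 < r ->
  r * sre (g (xalpha P r y)) + form P g (J r y) = r * sre (g y).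
Proof.
move=> r0.
have [z zE] : exists z : X, (emb r : K) *: z + P (duality_map z) = y.
  (* Dividing by r reduces solvability to the case of parameter 1. *)
  pose Q f : X := (emb r^-1 : K) *: P f.
  have QE f g' : form Q f g' = r^-1 * form P f g' by rewrite /form dualZ sre_emb.
  have [f h|f|z zE] := @duality_equation R c X Q _ _ ucX ((emb r^-1 : K) *: y).
  - by rewrite !QE formC.
  - by rewrite QE mulr_ge0 // invr_ge0 ltW.
  exists z; have := congr1 (fun x => (emb r : K) *: x) zE.
  by rewrite scalerDr !scalerA -embM mulfV ?gt_eqF // emb1 !scale1r.
have {zE} := @xgetPex _ 0
  [set z : X | (emb r : K) *: z + P (duality_map z) = y] (ex_intro _ z zE).
rewrite /xalpha; set w := xget _ _ => /= <-.
by rewrite duality_mapZ // formC formZl formC dualD sreD mulrDr.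
Qed.

Lemma nrm_xalpha_sqr r y : 0 < r ->
  nrm (xalpha P r y) ^+ 2 <= sre (J r y y).
Proof.
move=> r0; have := xalpha_equation y (J r y) r0.
by rewrite duality_map_self -(ler_pM2l r0); have := form_ge0 (J r y); lra.
Qed.

Lemma nrm_xalpha_le r y : 0 < r -> nrm (xalpha P r y) <= nrm y.
Proof.
move=> r0; have := nrm_xalpha_sqr y r0; have := dual_re_bound (J r y) y.
rewrite nrm_duality_map expr2; set n := nrm _ => n1 n2.
have [->|n0] := eqVneq n 0; first exact: sre_norm_ge0.
have n_gt0 : 0 < n by rewrite lt_def n0 sre_norm_ge0.
by rewrite -(ler_pM2l n_gt0); lra.
Qed.

Lemma form_xalpha_le r y : 0 < r ->
  form P (J r y) (J r y) <= r * nrm y ^+ 2.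
Proof.
move=> r0; have := xalpha_equation y (J r y) r0.
have := dual_re_bound (J r y) y; rewrite duality_map_self nrm_duality_map => Jy.
have : nrm (xalpha P r y) * nrm y <= nrm y * nrm y.
  by rewrite ler_wpM2r ?sre_norm_ge0 // nrm_xalpha_le.
move=> xy; have : r * sre (J r y y) <= r * (nrm y * nrm y).
  by rewrite ler_pM2l //; lra.
have : 0 <= r * nrm (xalpha P r y) ^+ 2 by rewrite mulr_ge0 ?sqr_ge0 // ltW.
by rewrite [nrm y ^+ 2]expr2; lra.
Qed.

Lemma duality_xalpha_cvg0 y x :
  (forall f, f != 0 -> 0 < f (P f) :> K) ->
  sre (J r y x) @[r --> 0^'+] --> (0 : R).
Proof.
(* [S] is a subspace whether or not [P] is linear. *)
move=> P_gt0; pose S := [set v | sre (J r y v) @[r --> 0^'+] --> (0 : R)].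
have S_P h : S (P h).
  (* Cauchy-Schwarz bounds the square of the real part by r (C - 1); the summand 1 makes C
     positive. *)
  apply/cvgr0Pnorm_lt => e e0; pose C := nrm y ^+ 2 * form P h h + 1.
  have C0 : 0 < C by rewrite ltr_wpDl // mulr_ge0 ?sqr_ge0.
  near=> r; have r0 : 0 < r by near: r; exact: nbhs_right_gt.
  rewrite -(ltr_pXn2r (n := 2)) ?nnegrE ?normr_ge0 ?(ltW e0) //.
  rewrite real_normK ?num_real //; apply: le_lt_trans (form_CS formC form_ge0 _ _) _.
  apply: (@le_lt_trans _ _ (r * (C - 1))).
    by rewrite /C addrK mulrA ler_wpM2r // form_xalpha_le.
  apply: (@lt_trans _ _ (r * C)); first by rewrite ltr_pM2l // gtrBl.
  rewrite -ltr_pdivlMr //; near: r; apply: nbhs_right_lt.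
  by rewrite divr_gt0 // exprn_gt0.
apply/cvgr0Pnorm_lt => e e0.
have y0 : 0 < nrm y + 1 by rewrite ltr_wpDl ?sre_norm_ge0.
have S0 : S 0.
  by rewrite /S /=; under eq_fun do rewrite dual0 sre0; exact: cvg_cst.
have SD v w : S v -> S w -> S (v + w).
  move=> Sv Sw; rewrite /S /=; under eq_fun do rewrite dualD sreD.
  have := cvgD Sv Sw; rewrite addr0; exact.
have SZ (a : R) v : S v -> S ((emb a : K) *: v).
  move=> Sv; rewrite /S /=; under eq_fun do rewrite dualZ sre_emb.
  have := cvgM (cvg_cst a) Sv; rewrite mulr0; exact.
have S_ann f : (forall v, S v -> sre (f v) = 0) -> f = 0.
  (* [S] contains P f, so a nonzero annihilator f would satisfy 0 < Re f(P f) = 0. *)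
  move=> fS; apply: contrapT => /eqP/P_gt0/ltr_sre; rewrite sre0.
  by rewrite (fS (P f)) ?ltxx //; exact: S_P.
have [|v Sv xv] := dense_of_annihilator S0 SD SZ S_ann x
  (e := e / 2 / (nrm y + 1)); first by rewrite !divr_gt0.
have nJ r : 0 < r -> nrm (J r y) * nrm (x - v) <= e / 2.
  move=> r0; rewrite nrm_duality_map.
  apply: le_trans (_ : _ <= (nrm y + 1) * (e / 2 / (nrm y + 1))) _.
    apply: ler_pM; rewrite ?sre_norm_ge0 //; last exact: ltW.
    by apply: le_trans (nrm_xalpha_le y r0) _; rewrite lerDl.
  by rewrite mulrC divfK ?gt_eqF.
near=> r; have r0 : 0 < r by near: r; exact: nbhs_right_gt.
have : `|sre (J r y v)| < e / 2.
  by near: r; move/cvgr0Pnorm_lt : Sv; apply; rewrite divr_gt0.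
have := nJ r r0; have := dual_re_bound (J r y) (x - v).
have := dual_re_bound (J r y) (v - x).
by rewrite nrm_distC !dualB !sreB !ltr_norml; lra.
Unshelve. all: by end_near. Qed.

(** By reflexivity phi is evaluation at some x; the real parts at x and at k x control the
    modulus. *)
Lemma xalpha_cvg0_weak : reflexive_space X ->
  (forall f, f != 0 -> 0 < f (P f) :> K) ->
  forall y, weakly_cvg (fun r => J r y) 0^'+ 0.
Proof.
move=> rX P_gt0 y phi; have [x phiE] := rX phi.
rewrite (_ : phi 0 = 0); last by rewrite dual0.
under eq_fun do rewrite phiE.
apply/(@nrm_cvg0P _ _ K^o).
have [k kP] := @norm_le_parts R c.
have J0 v : `|sre (J r y v)| @[r --> 0^'+] --> (0 : R).
  by have := cvg_norm (duality_xalpha_cvg0 y v P_gt0); rewrite normr0; exact.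
have := cvgD (J0 x) (J0 (k *: x)); rewrite addr0 => c0.
apply: (squeeze_cvgr (f := cst 0)); [|exact: cvg_cst|exact: c0].
near=> r; apply/andP; split; first exact: sre_norm_ge0.
by apply: le_trans (kP _) _; rewrite -dualZ.
Unshelve. all: by end_near. Qed.

Lemma xalpha_cvg0_strong y :
  weakly_cvg (fun r => J r y) 0^'+ 0 -> xalpha P r y @[r --> 0^'+] --> (0 : X).
Proof.
(* Evaluation at y is a bounded functional on the dual, so weak convergence can be tested on it. *)
move=> w0; have [|f|ev evE] := @dual_of_re R c (dual X) (fun f => f y) (nrm y).
- by move=> k f g; rewrite dual_addE dual_scaleE.
- by rewrite mulrC; exact: dual_re_bound.
have /sre_cvg : (ev (J r y) : K^o) @[r --> 0^'+] --> (0 : K^o).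
  by rewrite -(dual0 ev); exact: w0.
rewrite sre0 => /cvgr0Pnorm_lt ev0; apply/nrm_cvg0P/cvgr0Pnorm_lt => e e0.
near=> r; have r0 : 0 < r by near: r; exact: nbhs_right_gt.
rewrite ger0_norm ?sre_norm_ge0 //.
rewrite -(ltr_pXn2r (n := 2)) ?nnegrE ?sre_norm_ge0 ?(ltW e0) //.
apply: le_lt_trans (nrm_xalpha_sqr y r0) _; apply: le_lt_trans (ler_norm _) _.
rewrite -evE; near: r; apply: ev0; exact: exprn_gt0.
Unshelve. all: by end_near. Qed.

Lemma gramian_gt0 : (forall y, xalpha P r y @[r --> 0^'+] --> (0 : X)) ->
  forall f, f != 0 -> 0 < f (P f) :> K.
Proof.
move=> x0 f; apply: contra_neqT; rewrite lt_def P_ge0 andbT negbK => /eqP fPf.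
have f_0 g : form P f g = 0.
  have := form_CS formC form_ge0 f g; rewrite {2}/form fPf sre0 mul0r => fg.
  by apply/eqP; rewrite -sqrf_eq0 eq_le fg sqr_ge0.
apply: dual_ext => y; rewrite dual_0E sre0.
have /sre_cvg : f (xalpha P r y) @[r --> 0^'+] --> f 0.
  by apply: continuous_cvg; [exact: dual_continuous|exact: x0].
rewrite dual0 sre0 => fx.
apply: cvg_unique _ fx => //.
(* As f is in the kernel of the form, the equation reads Re f(x_r(y)) = Re f(y) for all r > 0. *)
apply: cvg_near_cst; near=> r.
have r0 : 0 < r by near: r; exact: nbhs_right_gt.
by have := xalpha_equation y f r0; rewrite f_0 addr0 => /(mulfI (lt0r_neq0 r0)).
Unshelve. all: by end_near. Qed.

End gramian.

(** * Hermitian symmetry and positivity of the product on controls *)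

Section control_product.
Context {R : realType} {c : bool} {U : normedModType (scal R c)} {m : nat}.
Local Notation K := (scal R c).
Variables (ip : {dot U for @sconj R c}) (b : R).
Implicit Types w : control U m.

Lemma ip_conj (u v : U) : ip u v = sconj (ip v u).
Proof. by rewrite [LHS]hermitian_subproof expr0 mul1r. Qed.

Lemma ctrl_ip_conj w w' : ctrl_ip b ip w w' = sconj (ctrl_ip b ip w' w).
Proof.
rewrite /ctrl_ip.
rewrite sconjD.
congr (_ + _).
  apply: etrans (bochner_conj (measurable_itv _) _).
  by congr bochner; apply/funext => s; exact: ip_conj.
rewrite sconj_sum.
by apply: eq_bigr => k _; exact: ip_conj.
Qed.

Lemma ctrl_ip_ge0 w : (forall u, ip u u = `|u| ^+ 2) -> 0 <= ctrl_ip b ip w w.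
Proof.
move=> ipE; apply: addr_ge0.
  apply: (bochner_ge0 _ (r := fun s => nrm (w.1 s) ^+ 2)) => // s.
  - by rewrite ipE norm_nrm !expr2 embM.
  - exact: sqr_ge0.
by apply: sumr_ge0 => k _; rewrite ipE exprn_ge0.
Qed.

End control_product.

(** * The equivalence for the controllability Gramian *)

Theorem theorem2p1 (R : realType) (c : bool)
    (X U : completeNormedModType (scal R c))
    (ip : {dot U for @sconj R c})
    (XC : complexification X)
    (b : R) (m : nat) (t : nat -> R)
    (A : operator X) (N : R -> operator X) (G : R -> X -> X)
    (B : U -> X) (D : nat -> X -> X) (E : nat -> U -> X)
    (theta a : R) (Ghat Nhat : Cplx R -> XC -> XC)
    (Rs : R -> X -> X)
    (Ms : dual X -> control U m)
    (X_separable : separable_space X)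
    (X_reflexive : reflexive_space X)
    (X_dual_convex : uniformly_convex (dual X))
    (U_hilbert : forall u : U, ip u u = `|u| ^+ 2)
    (m_gt0 : (0 < m)%N)
    (t_first : t 0%N = 0)
    (t_last : t m.+1 = b)
    (t_incr : forall k, (k <= m)%N -> t k < t k.+1)
    (A_closed : closed_op A)
    (N_closed : forall s : R, 0 <= s -> closed_op (N s))
    (B_bounded : bounded_op B)
    (D_bounded : forall k, (1 <= k <= m)%N -> bounded_op (D k))
    (E_bounded : forall k, (1 <= k <= m)%N -> bounded_op (E k))
    (hCd1 : Cd1 XC A theta)
    (hCd2 : Cd2 A G theta a Ghat)
    (hCd3 : Cd3 A N theta Nhat)
    (hCd4 : Cd4 A theta a Ghat Nhat)
    (hRs : resolvent_operator A G N Rs)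
    (hMs : is_adjoint b ip (ctrl_op b t Rs B D E) Ms) :
  let MMs : dual X -> X := fun f => ctrl_op b t Rs B D E (Ms f) in
  let strictly_positive :=
    forall f : dual X, f != 0 -> 0 < (f (MMs f) : scal R c) in
  let weak_to_0 :=
    forall h : X,
      weakly_cvg (fun alpha : R => duality_map (xalpha MMs alpha h)) 0^'+ 0 in
  let strong_to_0 :=
    forall y : X, xalpha MMs alpha y @[alpha --> 0^'+] --> (0 : X) in
  (strictly_positive <-> weak_to_0) /\ (weak_to_0 <-> strong_to_0).
Proof.
move=> MMs strictly_positive weak_to_0 strong_to_0.
(* The adjoint identity applies to the control [Ms g], itself square integrable, and gives f (MMs g)
   as the product of [Ms g] and [Ms f]. *)
have MMs_herm (f g : dual X) : f (MMs g) = sconj (g (MMs f) : scal R c) :> scal R c.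
  rewrite (hMs f).2; last exact: (hMs g).1.
  rewrite (hMs g).2; last exact: (hMs f).1.
  exact: ctrl_ip_conj.
have MMs_ge0 (f : dual X) : 0 <= f (MMs f) :> scal R c.
  by rewrite (hMs f).2; [exact: ctrl_ip_ge0|exact: (hMs f).1].
have weak : strictly_positive -> weak_to_0.
  by move=> pos; exact: xalpha_cvg0_weak.
have strong : weak_to_0 -> strong_to_0.
  by move=> w0 y; apply: xalpha_cvg0_strong.
have pos : strong_to_0 -> strictly_positive.
  by move=> s0; exact: gramian_gt0.
by split; split=> //; [move=> /strong/pos|move=> /pos/weak].
Qed.
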